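(* Let $G$ be a countable infinite discrete group such that the free group $\mathbb{F}_2$ on two generators orbitally embeds in $G$. Then for any infinite Abelian (discrete) group $A$, the wreath product $A\wr G$ is not unitarizable.
   Context: Orbital embedding: let $\Gamma, G$ be countable infinite groups. One says that $\Gamma$ orbitally embeds in $G$ if there are free measure-preserving actions $\Gamma\curvearrowright (X,\mu)$ and $G\curvearrowright (X,\mu)$ on the same standard probability space $(X,\mu)$ (i.e. a copy of $[0,1]$ with Lebesgue measure) such that $\Gamma x\subset Gx$ for $\mu$-almost every $x\in X$. Here ''free'' means that for a.e. $x$ the orbit map $\gamma\mapsto \gamma x$ (resp. $g\mapsto gx$) is injective. Unitarizable: a representation $\pi\colon G\to B(H)$ of a discrete group $G$ on a Hilbert space $H$ (a group homomorphism into the invertible bounded operators) is uniformly bounded if $\sup_{t\in G}\|\pi(t)\|<\infty$; it is unitarizable if there is a bounded invertible operator $S\colon H\to H$ such that $t\mapsto S^{-1}\pi(t)S$ is a unitary representation. The discrete group $G$ is unitarizable if every uniformly bounded representation of $G$ on every Hilbert space is unitarizable. Wreath product: $A^{(G)}$ is the group (under pointwise product) of functions $a\colon G\to A$ equal to the unit except at finitely many points; $G$ acts on it by $(g\cdot a)(t)=a(g^{-1}t)$. Then $A\wr G$ is the semidirect product $A^{(G)}\rtimes G$, i.e. the set of pairs $(a,g)$, $a\in A^{(G)}$, $g\in G$, with product $(a,g)(a',g')=(a\,(g\cdot a'),gg')$. *)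

(* Defs.v *)
From HB Require Import structures.
From mathcomp Require Import all_boot all_order all_algebra finmap.
From mathcomp Require Import all_classical all_reals all_analysis complex.

Set Implicit Arguments.
Unset Strict Implicit.
Unset Printing Implicit Defensive.

Import Order.TTheory GRing.Theory Num.Theory.
Import numFieldNormedType.Exports.

Local Open Scope classical_set_scope.
Local Open Scope ring_scope.

Section FreeGroup.
Variable T : choiceType.

(* [(x, false)] is the generator x and [(x, true)] its inverse. *)
Definition letter : Type := (T * bool)%type.

HB.instance Definition _ := Choice.on letter.

Definition letterV (x : letter) : letter := (x.1, ~~ x.2).

Definition reduced : pred (seq letter) := sorted (fun x y => y != letterV x).

Record free_group := FreeGroup { word :> seq letter; _ : reduced word }.

HB.instance Definition _ := [isSub for word].
HB.instance Definition _ := [Choice of free_group by <:].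

(* The reduced form of [x :: w], for w reduced. *)
Definition push (x : letter) (w : seq letter) : seq letter :=
  if w is y :: w' then if y == letterV x then w' else x :: w else [:: x].

Lemma letterVK : involutive letterV.
Proof. by case=> x b; rewrite /letterV /= negbK. Qed.

Lemma reduced_behead x w : reduced (x :: w) -> reduced w.
Proof. by rewrite /reduced /=; case: w => //= y w /andP[]. Qed.

Lemma push_reduced x w : reduced w -> reduced (push x w).
Proof.
case: w => [//|y w] rw /=; case: ifPn => yx; first exact: reduced_behead rw.
by rewrite /reduced /= yx.
Qed.

Lemma push_cons x w : reduced (x :: w) -> push x w = x :: w.
Proof. by case: w => [//|y w]; rewrite /reduced /= => /andP[/negPf->]. Qed.

Lemma pushVK x w : reduced w -> push x (push (letterV x) w) = w.
Proof.
case: w => [|y w] rw /=; first by rewrite eqxx.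
rewrite letterVK; case: eqVneq => [<-|yx /=]; first exact: push_cons.
by rewrite eqxx.
Qed.

Lemma foldr_push_reduced u v : reduced v -> reduced (foldr push v u).
Proof. by move=> rv; elim: u => //= x u; apply: push_reduced. Qed.

Lemma foldr_push_push x u v : reduced v ->
  foldr push v (push x u) = push x (foldr push v u).
Proof.
move=> rv; case: u => [//|y u] /=; case: eqVneq => [->|//].
by rewrite pushVK // foldr_push_reduced.
Qed.

Lemma foldr_push_foldr u v w : reduced w ->
  foldr push w (foldr push v u) = foldr push (foldr push w v) u.
Proof.
by move=> rw; elim: u => //= x u IHu; rewrite foldr_push_push // IHu.
Qed.

Definition wordV (w : seq letter) := rev (map letterV w).

Lemma wordVK : involutive wordV.
Proof. by move=> w; rewrite /wordV map_rev revK (mapK letterVK). Qed.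

Lemma foldr_pushV w : foldr push w (wordV w) = [::].
Proof.
elim: w => [//|x w IHw]; rewrite /wordV /= rev_cons foldr_rcons /=.
by rewrite letterVK eqxx.
Qed.

Lemma wordV_reduced w : reduced w -> reduced (wordV w).
Proof.
rewrite /reduced /wordV rev_sorted sorted_map.
by apply: sub_sorted => x y /=; rewrite letterVK eq_sym.
Qed.

Definition free_one : free_group := @FreeGroup [::] isT.
Definition free_inv (u : free_group) : free_group :=
  FreeGroup (wordV_reduced (valP u)).
Definition free_mul (u v : free_group) : free_group :=
  FreeGroup (foldr_push_reduced (val u) (valP v)).

Fact free_mulA : associative free_mul.
Proof.
by move=> u v w; apply/val_inj; rewrite /= foldr_push_foldr //; apply: (valP w).
Qed.
Fact free_mul1g : left_id free_one free_mul.
Proof. by move=> u; apply/val_inj. Qed.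
Fact free_mulg1 : right_id free_one free_mul.
Proof.
case=> w rw; apply/val_inj => /=; elim: w rw => //= x w IHw rw.
by rewrite IHw ?push_cons //; apply: reduced_behead rw.
Qed.
Fact free_mulVg : left_inverse free_one free_inv free_mul.
Proof. by move=> u; apply/val_inj; rewrite /= foldr_pushV. Qed.
Fact free_mulgV : right_inverse free_one free_inv free_mul.
Proof.
by move=> u; apply/val_inj; rewrite /= -{2}(wordVK (word u)) foldr_pushV.
Qed.

HB.instance Definition _ := isGroup.Build free_group
  free_mulA free_mul1g free_mulg1 free_mulVg free_mulgV.

End FreeGroup.

Notation F2 := (free_group bool).

Section Wreath.
Variables A G : groupType.
Local Open Scope fset_scope.

(* The underlying set of A^(G), written multiplicatively and pointwise. *)
Definition lamps : Type := {fsfun G -> A with 1%g}.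

HB.instance Definition _ := Choice.on lamps.

Implicit Types a b : lamps.

Definition lamps_mul a b : lamps :=
  [fsfun t in finsupp a `|` finsupp b => (a t * b t)%g].
Definition lamps_inv a : lamps := [fsfun t in finsupp a => (a t)^-1%g].
Definition lamps_act (g : G) a : lamps :=
  [fsfun t in [fset (g * s)%g | s in finsupp a] => a (g^-1 * t)%g].

Lemma lamps_mulE a b t : lamps_mul a b t = (a t * b t)%g.
Proof.
rewrite fsfunE inE; case: ifPn => //; rewrite negb_or => /andP[at1 bt1].
by rewrite !fsfun_dflt ?mulg1.
Qed.

Lemma lamps_invE a t : lamps_inv a t = (a t)^-1%g.
Proof. by rewrite fsfunE; case: ifPn => // at1; rewrite fsfun_dflt ?invg1. Qed.

Lemma lamps_actE g a t : lamps_act g a t = a (g^-1 * t)%g.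
Proof.
rewrite fsfunE; case: ifPn => // /imfsetP gt; rewrite fsfun_dflt //.
apply/negP => agt; apply: gt; exists (g^-1 * t)%g => //.
by rewrite mulVKg.
Qed.

Record wreath := Wreath { wreath_base : lamps; wreath_top : G }.

Definition wreath_pair w := (wreath_base w, wreath_top w).
Definition pair_wreath p := Wreath p.1 p.2.
Fact wreath_pairK : cancel wreath_pair pair_wreath. Proof. by case. Qed.
HB.instance Definition _ := Choice.copy wreath (can_type wreath_pairK).

Definition wreath_one := Wreath [fsfun with 1%g] 1%g.
Definition wreath_mul (x y : wreath) :=
  Wreath (lamps_mul (wreath_base x) (lamps_act (wreath_top x) (wreath_base y)))
         (wreath_top x * wreath_top y)%g.
Definition wreath_inv (x : wreath) :=
  Wreath (lamps_act (wreath_top x)^-1%g (lamps_inv (wreath_base x)))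
         (wreath_top x)^-1%g.

Let lampsE := (lamps_mulE, lamps_invE, lamps_actE, fsfun0E).

Fact wreath_mulA : associative wreath_mul.
Proof.
case=> [a g] [b h] [c k]; rewrite /wreath_mul /= mulgA; congr Wreath.
by apply/fsfunP => t; rewrite !lampsE invgM !mulgA.
Qed.
Fact wreath_mul1g : left_id wreath_one wreath_mul.
Proof.
case=> [a g]; rewrite /wreath_mul /= mul1g; congr Wreath.
by apply/fsfunP => t; rewrite !lampsE invg1 !mul1g.
Qed.
Fact wreath_mulg1 : right_id wreath_one wreath_mul.
Proof.
case=> [a g]; rewrite /wreath_mul /= mulg1; congr Wreath.
by apply/fsfunP => t; rewrite !lampsE mulg1.
Qed.
Fact wreath_mulVg : left_inverse wreath_one wreath_inv wreath_mul.
Proof.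
case=> [a g]; rewrite /wreath_mul /= mulVg; congr Wreath.
by apply/fsfunP => t; rewrite !lampsE mulVg.
Qed.
Fact wreath_mulgV : right_inverse wreath_one wreath_inv wreath_mul.
Proof.
case=> [a g]; rewrite /wreath_mul /= mulgV; congr Wreath.
by apply/fsfunP => t; rewrite !lampsE invgK mulVKg mulgV.
Qed.

HB.instance Definition _ := isGroup.Build wreath
  wreath_mulA wreath_mul1g wreath_mulg1 wreath_mulVg wreath_mulgV.

End Wreath.

Section OrbitalEmbedding.
Variable R : realType.

(* A strict isomorphism with [0, 1] carrying its Borel sets and Lebesgue
   measure: no null set has to be discarded. *)
Definition standard_probability d (X : measurableType d)
    (mu : probability X R) : Prop :=
  exists phi : X -> measurableTypeR R,
  [/\ set_bij [set: X] `[0, 1]%classic phi,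
      measurable_fun [set: X] phi,
      forall B, measurable B -> measurable (phi @` B) &
      forall B : set (measurableTypeR R), measurable B ->
        mu (phi @^-1` B) = lebesgue_measure (B `&` `[0, 1]%classic)].

Definition is_action (G : groupType) (X : Type) (act : G -> X -> X) : Prop :=
  (forall x, act 1%g x = x) /\
  (forall g h x, act (g * h)%g x = act g (act h x)).

Definition measure_preserving_action (G : groupType) d (X : measurableType d)
    (mu : probability X R) (act : G -> X -> X) : Prop :=
  [/\ is_action act,
      forall g, measurable_fun [set: X] (act g) &
      forall g B, measurable B -> mu (act g @^-1` B) = mu B].

Definition free_action (G : groupType) d (X : measurableType d)
    (mu : probability X R) (act : G -> X -> X) : Prop :=
  {ae mu, forall x, injective (act ^~ x)}.

Definition orbitally_embeds (Gamma G : groupType) : Prop :=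
  exists (d : measure_display) (X : measurableType d) (mu : probability X R)
    (alpha : Gamma -> X -> X) (beta : G -> X -> X),
  [/\ standard_probability mu,
      measure_preserving_action mu alpha /\ free_action mu alpha,
      measure_preserving_action mu beta /\ free_action mu beta &
      {ae mu, forall x, range (alpha ^~ x) `<=` range (beta ^~ x)}].

End OrbitalEmbedding.

(* The inner product is linear in its first argument. Norms of vectors are
   elements of [R[i]] whose imaginary part is 0. *)
Record hilbertSpace (R : realType) := HilbertSpace {
  hilbert_sort :> completeNormedModType R[i];
  inner : {dot hilbert_sort for Num.conj};
  inner_norm : forall x : hilbert_sort, `|x| ^+ 2 = inner x x }.

Section Unitarizable.
Variable R : realType.

Section Operators.
Variable H : hilbertSpace R.
Implicit Types S U : {linear H -> H}.

Definition opnorm S : \bar R :=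
  ereal_sup [set (complex.Re `|S x|)%:E | x in [set x : H | `|x| <= 1]].

Definition bounded_operator S : Prop := (opnorm S < +oo)%E.

Definition unitary_operator U : Prop :=
  bijective U /\ forall x y, inner H (U x) (U y) = inner H x y.

Variable G : groupType.
Implicit Type pi : G -> {linear H -> H}.

Definition representation pi : Prop :=
  [/\ forall t, bounded_operator (pi t),
      forall x, pi 1%g x = x &
      forall s t x, pi (s * t)%g x = pi s (pi t x)].

Definition uniformly_bounded pi : Prop :=
  (ereal_sup (range (fun t => opnorm (pi t))) < +oo)%E.

Definition unitary_representation pi : Prop :=
  representation pi /\ forall t, unitary_operator (pi t).

Definition unitarizable_representation pi : Prop :=
  exists S S' : {linear H -> H},
  [/\ bounded_operator S, bounded_operator S',
      cancel S S', cancel S' S &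
      unitary_representation (fun t => S' \o (pi t \o S))].

End Operators.

Definition unitarizable (G : groupType) : Prop :=
  forall (H : hilbertSpace R) (pi : G -> {linear H -> H}),
    representation pi -> uniformly_bounded pi -> unitarizable_representation pi.

End Unitarizable.

(* Main.v *)
(* Let [X] carry the two actions, and let [H] be the space of
   square-integrable fields [x |-> f x] with [f x] in l^2(Gx). On it [G] acts
   by translation, and [A^(G)] by multiplication by [x |-> prod_s theta(s^-1
   x)(a s)], where [theta] is a map from [X] to the characters of [A] with
   finitely many values. Take [g_0, g_1, ...] in F2 in ping-pong position
   for sets [L_i] that contain [g_i^-1] but not 1, and put
   [P f x y = sum_(i < n) 1_(s(x,y) notin L_i) f x (g_i y)], where
   [s(x,y)] is the position of [y] in its F2-orbit relative to a root of that
   orbit chosen from [x], the root of F2 x being [x]. The commutators of [P]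
   with the group are at most 2 in norm, uniformly in [n], since the sets
   [L_i] are disjoint and so are the sets [g_i (F2 \ L_i)]: changing the root
   affects few entries.

   A bounded operator [T] with the same commutators as [P] satisfies [|T| >=
   c sqrt n]. Indeed [T] commutes with [A^(G)], hence with the indicators of
   the level sets of [theta]; if these separate the finitely many elements of
   [G] by which [g_i] acts on most of [X], then [P - T] commutes with [g_i]
   there, so that its entries at [(x, g_i x)] and [(g_i^-1 x, x)] have the
   same mean, whereas these entries of [P] are 1 and 0. Bessel's inequality
   for the row and the column of [T] through the diagonal gives the bound.

   Summing over [n] yields a bounded derivation [D] that no bounded operator
   implements. If the uniformly bounded representation [(L D; 0 L)] were
   unitarizable, the invariant subspace would have an invariant complement,
   which is the graph of such an operator. The space of fields is not
   completed: the contragredient representation on its dual is used instead. *)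

Require Import Defs.
From HB Require Import structures.
From mathcomp Require Import all_boot all_order all_algebra finmap.
From mathcomp Require Import all_classical all_reals all_analysis complex.
From mathcomp Require Import measurable_realfun lra ring zify.

Set Implicit Arguments.
Unset Strict Implicit.
Unset Printing Implicit Defensive.

Import Order.TTheory GRing.Theory Num.Theory.
Import numFieldNormedType.Exports.

Local Open Scope classical_set_scope.
Local Open Scope ring_scope.

(** * Pre-Hilbert spaces and their duals *)

Section SquaredModulus.
Variable R : realType.
Implicit Types (z w : R[i]) (a b c d : R).

Definition sqc z : R := complex.Re z ^+ 2 + complex.Im z ^+ 2.

Lemma sqc_ge0 z : 0 <= sqc z.
Proof. by rewrite addr_ge0 ?sqr_ge0. Qed.

Lemma sqcE z : (sqc z)%:C%C = `|z| ^+ 2.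
Proof. exact: add_Re2_Im2. Qed.

Lemma sqcJ z : (sqc z)%:C%C = z * z^*%C.
Proof. by rewrite sqcE sqr_normc. Qed.

Lemma sqcM z w : sqc (z * w) = sqc z * sqc w.
Proof. by case: z w => a b [c d]; rewrite /sqc /=; ring. Qed.

Lemma sqcX z n : sqc (z ^+ n) = sqc z ^+ n.
Proof.
elim: n => [|n IHn]; last by rewrite !exprS sqcM IHn.
by rewrite !expr0 /sqc /= expr0n addr0 expr1n.
Qed.

Lemma sqcN z : sqc (- z) = sqc z.
Proof. by case: z => a b; rewrite /sqc /= !sqrrN. Qed.

Lemma sqc_conj z : sqc z^*%C = sqc z.
Proof. by case: z => a b; rewrite /sqc /= sqrrN. Qed.

Lemma sqc_real a : sqc a%:C%C = a ^+ 2.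
Proof. by rewrite /sqc /= expr0n addr0. Qed.

Lemma sqc0 : sqc 0 = 0.
Proof. by rewrite /sqc /= expr0n addr0. Qed.

Lemma sqc1 : sqc 1 = 1.
Proof. by rewrite /sqc /= expr0n addr0 expr1n. Qed.

Lemma sqc_nat n : sqc n%:R = n%:R ^+ 2.
Proof. by rewrite -(rmorph_nat (real_complex R)) sqc_real. Qed.

Lemma sqc_eq0 z : (sqc z == 0) = (z == 0).
Proof.
case: z => a b; rewrite /sqc /= paddr_eq0 ?sqr_ge0 // !sqrf_eq0.
by rewrite eq_complex.
Qed.

Lemma sqcV z : sqc z^-1 = (sqc z)^-1.
Proof.
have [->|z0] := eqVneq z 0; first by rewrite invr0 sqc0 invr0.
apply: (@mulfI _ (sqc z)); first by rewrite sqc_eq0.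
by rewrite -sqcM !divff ?sqc1 ?sqc_eq0.
Qed.

Lemma sqr_Re_le z : complex.Re z ^+ 2 <= sqc z.
Proof. by rewrite lerDl sqr_ge0. Qed.

Lemma sqr_Im_le z : complex.Im z ^+ 2 <= sqc z.
Proof. by rewrite lerDr sqr_ge0. Qed.

(* Cauchy-Schwarz in the plane, for [|z| <= sqrt (a c)], [|w| <= sqrt (b d)]. *)
Lemma sqcD_le z w a b c d : 0 <= a -> 0 <= b -> 0 <= c -> 0 <= d ->
  sqc z <= a * c -> sqc w <= b * d -> sqc (z + w) <= (a + b) * (c + d).
Proof.
move=> a0 b0 c0 d0 zac wbd.
have -> : sqc (z + w) = sqc z + sqc w
    + 2 * (complex.Re z * complex.Re w + complex.Im z * complex.Im w).
  by case: z w {zac wbd} => x y [x' y']; rewrite /sqc /=; ring.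
set t := _ + complex.Im z * _.
have tzw : t ^+ 2 <= sqc z * sqc w.
  rewrite -subr_ge0 (_ : _ - _ = (complex.Re z * complex.Im w
    - complex.Im z * complex.Re w) ^+ 2) ?sqr_ge0 //.
  by rewrite /t /sqc; ring.
have tle : t ^+ 2 <= (a * d) * (b * c).
  apply: (le_trans tzw); rewrite (_ : a * d * _ = (a * c) * (b * d)); last ring.
  by rewrite ler_pM ?sqc_ge0.
have tle2 : 2 * t <= a * d + b * c.
  rewrite leNgt; apply/negP => lt_t.
  have ad0 : 0 <= a * d by rewrite mulr_ge0.
  have bc0 : 0 <= b * c by rewrite mulr_ge0.
  have h1 : (a * d + b * c) ^+ 2 < (2 * t) ^+ 2.
    by rewrite ltr_pXn2r // nnegrE ?addr_ge0 // ltW // (le_lt_trans _ lt_t) //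
      addr_ge0.
  have := sqr_ge0 (a * d - b * c); move: h1 tle; rewrite !expr2; lra.
by lra.
Qed.

Lemma sqcD_le2 z w : sqc (z + w) <= 2 * (sqc z + sqc w).
Proof.
rewrite (_ : 2 = 1 + 1 :> R); last by rewrite -natr1.
by apply: sqcD_le; rewrite ?sqc_ge0 ?mul1r ?ler01 ?lexx.
Qed.

End SquaredModulus.

(* [sqn] is the square of a seminorm; vectors of seminorm 0 are allowed. *)
Record preHilbert (R : realType) := PreHilbert {
  ph_sort :> lmodType R[i];
  sqn : ph_sort -> R;
  sqn_ge0 : forall u, 0 <= sqn u;
  sqnZ : forall c u, sqn (c *: u) = sqc c * sqn u;
  sqn_par : forall u v,
    sqn (u + v) + sqn (u - v) = 2 * sqn u + 2 * sqn v }.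

Section Polarization.
Variables (R : realType) (P : preHilbert R).
Implicit Types (u v w : P) (t : R).
Notation n := (@sqn R P).

(** By polarization this must be the real part of the inner product; that it is a bilinear form over
    the reals is the Jordan-von Neumann theorem, proved below from the parallelogram law alone. *)
Definition repolar u v : R := (n (u + v) - n (u - v)) / 4.

Lemma sqnN u : n (- u) = n u.
Proof. by rewrite -scaleN1r sqnZ sqcN sqc1 mul1r. Qed.

Lemma sqn0 : n 0 = 0.
Proof. by rewrite -(scale0r (0 : P)) sqnZ sqc0 mul0r. Qed.

Lemma sqnBC u v : n (u - v) = n (v - u).
Proof. by rewrite -opprB sqnN. Qed.

Lemma sqnZi u : n ('i%C *: u) = n u.
Proof. by rewrite sqnZ /sqc /= expr0n expr1n add0r mul1r. Qed.

Lemma repolarC u v : repolar u v = repolar v u.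
Proof. by rewrite /repolar (addrC u) (sqnBC u). Qed.

Lemma repolarii u v : repolar ('i%C *: u) ('i%C *: v) = repolar u v.
Proof. by rewrite /repolar -scalerDr -scalerBr !sqnZi. Qed.

(** Add the parallelogram laws for [u + v, u'] and [u' + v, u] and subtract those for [u - v, u']
    and [u' - v, u]: the terms in [u - u' + v] and [u - u' - v] cancel. *)
Lemma repolarDl u u' v : repolar (u + u') v = repolar u v + repolar u' v.
Proof.
have := sqn_par (u + v) u'; have := sqn_par (u - v) u'.
have := sqn_par (u' + v) u; have := sqn_par (u' - v) u.
rewrite /repolar.
rewrite [u' - v - u]addrAC -(opprB u u') -opprD sqnN.
rewrite [u' + v - u]addrAC -(opprB u u') (addrC _ v) (sqnBC v).
rewrite [u' - v + u]addrAC (addrC u' u) [u' + v + u]addrAC (addrC u' u).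
rewrite [u - v - u']addrAC [u - v + u']addrAC [u + v - u']addrAC.
rewrite [u + v + u']addrAC; lra.
Qed.

Lemma repolarNl u v : repolar (- u) v = - repolar u v.
Proof.
have := repolarDl u (- u) v; rewrite subrr => h.
have : repolar 0 v = 0 by rewrite /repolar add0r sub0r sqnN subrr mul0r.
by move: h; lra.
Qed.

Lemma repolarNr u v : repolar u (- v) = - repolar u v.
Proof. by rewrite repolarC repolarNl repolarC. Qed.

Lemma repolar_le u v : `|repolar u v| <= (n u + n v) / 2.
Proof.
have := sqn_par u v; have := sqn_ge0 (u + v); have := sqn_ge0 (u - v).
by rewrite ler_norml /repolar; lra.
Qed.

(* The defect [repolar (t u) v - t (repolar u v)] is additive in [t], has
   period 1 and is bounded on [0, 1], hence it vanishes. *)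
Lemma repolarZl t u v : repolar (t%:C%C *: u) v = t * repolar u v.
Proof.
pose g t := repolar (t%:C%C *: u) v - t * repolar u v.
suff : g t = 0 by rewrite /g; lra.
have gD a b : g (a + b) = g a + g b.
  by rewrite /g rmorphD scalerDl repolarDl; lra.
have g1 : g 1 = 0 by rewrite /g rmorph1 scale1r mul1r subrr.
have g0 : g 0 = 0 by have := gD 0 0; rewrite addr0; lra.
have gMn a k : g (k%:R * a) = k%:R * g a.
  elim: k => [|k IH]; first by rewrite !mul0r.
  by rewrite -natr1 mulrDl mul1r gD IH; lra.
have gN a : g (- a) = - g a by have := gD a (- a); rewrite subrr; lra.
have gZ (k : int) : g k%:~R = 0.
  have gk (m : nat) : g m%:R = 0 by rewrite -[_%:R]mulr1 gMn g1 mulr0.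
  case: k => m; first by rewrite -pmulrn gk.
  by rewrite NegzE mulrNz gN -pmulrn gk oppr0.
pose M := (n u + n v) / 2 + `|repolar u v|.
have gM a : `|g a| <= M.
  pose b := a - (Num.floor a)%:~R.
  have -> : g a = g b by rewrite /b gD gN gZ subr0.
  have b0 : 0 <= b by rewrite /b subr_ge0 ge_floor.
  have b1 : b <= 1.
    have := lt_succ_floor a; rewrite /b intrD; lra.
  rewrite /g (le_trans (ler_normB _ _)) // lerD //.
    apply: (le_trans (repolar_le _ _)); rewrite sqnZ sqc_real.
    have : b ^+ 2 * n u <= 1 * n u.
      by rewrite ler_wpM2r ?sqn_ge0 // expr_le1.
    by lra.
  by rewrite normrM ger0_norm // ler_piMl.
apply/eqP; rewrite -normr_eq0 eq_le normr_ge0 andbT leNgt; apply/negP => g_gt0.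
have M0 : 0 <= M / `|g t| by rewrite divr_ge0 // (le_trans (normr_ge0 _) (gM
  0)).
have := archi_boundP M0; rewrite ltr_pdivrMr // => lt_M.
by have := le_lt_trans (gM ((Num.bound (M / `|g t|))%:R * t)) lt_M; rewrite gMn
  normrM normr_nat ltxx.
Qed.

End Polarization.

(** The form is linear in [u], so [<u, iv> = -i <u, v>], whose real part is the imaginary part of
    [<u, v>]. *)
HB.lock Definition polar (R : realType) (P : preHilbert R) (u v : P) : R[i] :=
  (repolar u v +i* repolar u ('i%C *: v))%C.

Section Polar.
Variables (R : realType) (P : preHilbert R).
Implicit Types (u v w : P) (c : R[i]).
Notation n := (@sqn R P).

Lemma Re_polar u v : complex.Re (polar u v) = repolar u v.
Proof. by rewrite polar.unlock. Qed.

Lemma polarDl u u' v : polar (u + u') v = polar u v + polar u' v.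
Proof. by rewrite polar.unlock !repolarDl. Qed.

Lemma polarZl c u v : polar (c *: u) v = c * polar u v.
Proof.
have Hi w : repolar ('i%C *: u) w = - repolar u ('i%C *: w).
  rewrite -[in LHS](repolarii) scalerA -expr2 sqr_i scaleN1r repolarNl.
  by [].
have -> : c *: u = (complex.Re c)%:C%C *: u + (complex.Im c)%:C%C *: ('i%C *:
  u).
  rewrite {1}[c]complexE scalerDl scalerA; congr (_ + _ *: _); exact: mulrC.
rewrite polar.unlock !repolarDl !repolarZl !Hi scalerA -expr2 sqr_i scaleN1r.
rewrite repolarNr opprK.
by case: c => a b; apply/eqP; rewrite eq_complex /=; apply/andP; split;
  apply/eqP; ring.
Qed.

Lemma polarC u v : polar v u = (polar u v)^*%C.
Proof.
rewrite polar.unlock /=; congr Complex; first exact: repolarC.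
rewrite repolarC -(repolarii u) scalerA -expr2 sqr_i scaleN1r repolarNr.
by rewrite opprK.
Qed.

Lemma polarDr u v v' : polar u (v + v') = polar u v + polar u v'.
Proof. by rewrite polarC polarDl rmorphD /= -!polarC. Qed.

Lemma polarZr c u v : polar u (c *: v) = c^*%C * polar u v.
Proof. by rewrite polarC polarZl rmorphM /= -polarC. Qed.

Lemma polarNl u v : polar (- u) v = - polar u v.
Proof. by rewrite -scaleN1r polarZl mulN1r. Qed.

Lemma polarBl u u' v : polar (u - u') v = polar u v - polar u' v.
Proof. by rewrite polarDl polarNl. Qed.

Lemma polar0l v : polar 0 v = 0.
Proof. by rewrite -(scale0r (0 : P)) polarZl mul0r. Qed.

Lemma polar_suml I (r : seq I) (Q : pred I) (F : I -> P) v :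
  polar (\sum_(i <- r | Q i) F i) v = \sum_(i <- r | Q i) polar (F i) v.
Proof.
by elim/big_rec2: _ => [|i x y _ <-]; rewrite ?polar0l ?polarDl.
Qed.

Lemma polar0r u : polar u 0 = 0.
Proof. by rewrite polarC polar0l rmorph0. Qed.

Lemma polar_sumr I (r : seq I) (Q : pred I) (F : I -> P) u :
  polar u (\sum_(i <- r | Q i) F i) = \sum_(i <- r | Q i) polar u (F i).
Proof.
by elim/big_rec2: _ => [|i x y _ <-]; rewrite ?polar0r ?polarDr.
Qed.

Lemma polar_self u : polar u u = (n u)%:C%C.
Proof.
have rs w : repolar w w = n w.
  rewrite /repolar subrr sqn0 subr0 -mulr2n -scaler_nat sqnZ sqc_nat.
  by rewrite -natrX mulrAC divff ?mul1r.
rewrite polar.unlock; congr Complex; first exact: rs.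
have := repolarii u ('i%C *: u); rewrite scalerA -expr2 sqr_i scaleN1r.
by rewrite repolarNr (repolarC _ u); lra.
Qed.

Lemma sqnD u v : n (u + v) = n u + n v + 2 * complex.Re (polar u v).
Proof. by have := sqn_par u v; rewrite Re_polar /repolar; lra. Qed.

(** For the real part, [n (u + t w)] is a nonnegative quadratic polynomial in [t], evaluated at its
    minimum. The complex case follows by taking [w = z v] with [z = <u, v>], since [<u, z v>] is the
    real number [|z|^2]. *)
Lemma Cauchy_Schwarz u v : sqc (polar u v) <= n u * n v.
Proof.
have re w : repolar u w ^+ 2 <= n u * n w.
  have q t : 0 <= n u + t ^+ 2 * n w + 2 * t * repolar u w.
    have := sqn_ge0 (u + t%:C%C *: w).
    by rewrite sqnD sqnZ sqc_real Re_polar repolarC repolarZl repolarC; lra.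
  have [w0|w0] := eqVneq (n w) 0.
    have [->|r0] := eqVneq (repolar u w) 0; first by rewrite w0 mulr0 expr0n.
    (* When [n w = 0] the polynomial is affine in [t]; at this [t] it equals -1. *)
    have := q (- (n u + 1) / (2 * repolar u w)); rewrite w0 mulr0 addr0.
    rewrite (_ : 2 * _ * _ = - (n u + 1)); first by lra.
    by field; rewrite r0.
  have w_gt0 : 0 < n w by rewrite lt_def w0 sqn_ge0.
  have := q (- repolar u w / n w).
  rewrite (_ : _ + _ + _ = (n u * n w - repolar u w ^+ 2) / n w).
    by rewrite pmulr_lge0 ?invr_gt0 // subr_ge0.
  by field.
set z := polar u v.
have := re (z *: v); rewrite [repolar _ _](_ : _ = sqc z); last first.
  have : polar u (z *: v) = (sqc z)%:C%C by rewrite polarZr -/z mulrC sqcJ.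
  by move=> /(congr1 (@complex.Re R)); rewrite Re_polar.
rewrite sqnZ; have [->|z0] := eqVneq (sqc z) 0.
  by move=> _; rewrite mulr_ge0 ?sqn_ge0.
by rewrite expr2 mulrCA ler_pM2l // lt_def z0 sqc_ge0.
Qed.

Lemma sqrt_sqnD u v : Num.sqrt (n (u + v)) <= Num.sqrt (n u) + Num.sqrt (n v).
Proof.
rewrite -(@ler_pXn2r _ 2) // ?nnegrE ?addr_ge0 ?sqrtr_ge0 //.
rewrite sqrrD !sqr_sqrtr ?sqn_ge0 // sqnD.
suff : complex.Re (polar u v) <= Num.sqrt (n u) * Num.sqrt (n v) by lra.
apply: (le_trans (ler_norm _)); rewrite -sqrtrM ?sqn_ge0 // -sqrtr_sqr.
by rewrite ler_wsqrtr // (le_trans (sqr_Re_le _)) // Cauchy_Schwarz.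
Qed.

Lemma sqnD_le2 u v : n (u + v) <= 2 * (n u + n v).
Proof. by have := sqn_par u v; have := sqn_ge0 (u - v); lra. Qed.

Lemma sqn_sum_orthogonal (I : finType) (Q : pred I) (F : I -> P) :
  (forall i j, Q i -> Q j -> i != j -> polar (F i) (F j) = 0) ->
  n (\sum_(i | Q i) F i) = \sum_(i | Q i) n (F i).
Proof.
move=> o; apply: complexI; rewrite -polar_self polar_suml rmorph_sum.
apply: eq_bigr => i Qi; rewrite polar_sumr (bigD1 i) //= big1 => [|j /andP[Qj
  ji]].
  by rewrite addr0 polar_self.
by apply: o => //; rewrite eq_sym.
Qed.

End Polar.

Section ProductPreHilbert.
Variables (R : realType) (P Q : preHilbert R).

Definition prod_sqn (u : (P * Q)%type) : R := sqn u.1 + sqn u.2.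

Fact prod_sqn_ge0 u : 0 <= prod_sqn u.
Proof. by rewrite addr_ge0 ?sqn_ge0. Qed.
Fact prod_sqnZ c u : prod_sqn (c *: u) = sqc c * prod_sqn u.
Proof. by rewrite /prod_sqn !sqnZ mulrDr. Qed.
Fact prod_sqn_par u v :
  prod_sqn (u + v) + prod_sqn (u - v) = 2 * prod_sqn u + 2 * prod_sqn v.
Proof.
by have := sqn_par u.1 v.1; have := sqn_par u.2 v.2; rewrite /prod_sqn /=; lra.
Qed.

Definition prod_preHilbert : preHilbert R :=
  PreHilbert prod_sqn_ge0 prod_sqnZ prod_sqn_par.

Lemma prod_sqnE (u : prod_preHilbert) : sqn u = sqn u.1 + sqn u.2.
Proof. by []. Qed.

End ProductPreHilbert.

Section Dual.
Variables (R : realType) (P : preHilbert R).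

Definition bounded_functional (f : P -> R[i]) : Prop :=
  (forall c u v, f (c *: u + v) = c * f u + f v) /\
  exists M : R, forall v, sqc (f v) <= M * sqn v.

Definition dual_pred : {pred P -> R[i]} := [pred f | `[< bounded_functional f
  >]].

Fact dual_pred_submod : submod_closed dual_pred.
Proof.
split=> [|c f g].
  apply/asboolP; split=> [a u v|]; last first.
    by exists 0 => v; rewrite sqc0 mul0r.
  by rewrite -[LHS]/0 -[RHS]/(a * 0 + 0) mulr0 addr0.
move=> /asboolP[fl [M fM]] /asboolP[gl [N gN]].
apply/asboolP; split=> [a u v|].
  by rewrite -[LHS]/(c * f (a *: u + v) + g (a *: u + v)) fl gl
    -[RHS]/(a * (c * f u + g u) + (c * f v + g v)); ring.
exists (2 * (sqc c * M + N)) => v; rewrite -[X in sqc X]/(c * f v + g v).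
apply: (le_trans (sqcD_le2 _ _)); rewrite -mulrA ler_wpM2l //.
by rewrite mulrDl lerD ?gN // -mulrA sqcM ler_wpM2l ?sqc_ge0 ?fM.
Qed.

HB.instance Definition _ := GRing.isSubmodClosed.Build R[i] (P -> R[i])
  dual_pred
  dual_pred_submod.

Record dual := Dual { dual_fun :> P -> R[i]; _ : dual_fun \in dual_pred }.
HB.instance Definition _ := [isSub for dual_fun].
HB.instance Definition _ := [Choice of dual by <:].
HB.instance Definition _ := [SubChoice_isSubLmodule of dual by <:].

End Dual.

Section DualNorm.
Variables (R : realType) (P : preHilbert R).
Implicit Types (f g h : dual P) (u v : P) (c : R[i]).

Lemma dual_linear f c u v : f (c *: u + v) = c * f u + f v.
Proof. by have /asboolP[fl _] := valP f; exact: fl. Qed.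

Lemma dual0r f : f 0 = 0.
Proof. by have := dual_linear f (-1) 0 0; rewrite scaler0 addr0 mulN1r addNr.
  Qed.

Lemma dualDr f u v : f (u + v) = f u + f v.
Proof. by have := dual_linear f 1 u v; rewrite scale1r mul1r. Qed.

Lemma dualZr f c u : f (c *: u) = c * f u.
Proof. by have := dual_linear f c u 0; rewrite addr0 dual0r addr0. Qed.

Lemma dualNr f u : f (- u) = - f u.
Proof. by rewrite -scaleN1r dualZr mulN1r. Qed.

Lemma dualDE f g u : (f + g) u = f u + g u. Proof. by []. Qed.
Lemma dualZE c f u : (c *: f) u = c * f u. Proof. by []. Qed.
Lemma dualNE f u : (- f) u = - f u. Proof. by []. Qed.

Lemma dualP f g : f =1 g -> f = g.
Proof. by move=> fg; apply/val_inj/funext. Qed.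

Lemma mk_dual (f : P -> R[i]) (M : R) :
  (forall c u v, f (c *: u + v) = c * f u + f v) ->
  (forall v, sqc (f v) <= M * sqn v) -> exists F : dual P, dual_fun F = f.
Proof.
move=> fl fM; have fd : f \in @dual_pred R P by apply/asboolP; split; last by
  exists M.
by exists (Dual fd).
Qed.

Definition dual_sqn f : R := sup [set sqc (f v) | v in [set v | sqn v <= 1]].

Let has_sup_dual f : has_sup [set sqc (f v) | v in [set v | sqn v <= 1]].
Proof.
split; first by exists (sqc (f 0)), 0 => //=; rewrite sqn0.
have /asboolP[_ [M fM]] := valP f; exists `|M| => _ [v /= v1 <-].
apply: (le_trans (fM v)); apply: (le_trans (ler_norm _)).
by rewrite normrM ler_piMr // ger0_norm ?sqn_ge0.
Qed.

Lemma dual_sqn_ge0 f : 0 <= dual_sqn f.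
Proof.
apply: (@le_trans _ _ (sqc (f 0))); first exact: sqc_ge0.
by apply: (ub_le_sup (has_sup_dual f).2); exists 0 => //=; rewrite sqn0.
Qed.

Lemma sqc_dual_le f v : sqc (f v) <= dual_sqn f * sqn v.
Proof.
have [v0|v0] := eqVneq (sqn v) 0.
  by have /asboolP[_ [M /(_ v)]] := valP f; rewrite v0 !mulr0.
have v_gt0 : 0 < sqn v by rewrite lt_def v0 sqn_ge0.
pose c : R[i] := ((Num.sqrt (sqn v))^-1)%:C%C.
have cE : sqc c = (sqn v)^-1 by rewrite sqc_real exprVn sqr_sqrtr ?sqn_ge0.
rewrite -ler_pdivrMr // mulrC -cE -sqcM -dualZr.
apply: (ub_le_sup (has_sup_dual f).2); exists (c *: v) => //=.
by rewrite sqnZ cE mulVf.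
Qed.

Lemma dual_sqn_le f M : 0 <= M -> (forall v, sqc (f v) <= M * sqn v) ->
  dual_sqn f <= M.
Proof.
move=> M0 fM; apply: ge_sup; first exact: (has_sup_dual f).1.
move=> _ [v /= v1 <-]; apply: (le_trans (fM v)).
by rewrite ler_piMr.
Qed.

Lemma dual_sqnZ c f : dual_sqn (c *: f) = sqc c * dual_sqn f.
Proof.
have le d g : dual_sqn (d *: g) <= sqc d * dual_sqn g.
  apply: dual_sqn_le => [|v]; first by rewrite mulr_ge0 ?sqc_ge0 ?dual_sqn_ge0.
  by rewrite dualZE sqcM -mulrA ler_wpM2l ?sqc_ge0 ?sqc_dual_le.
have [->|c0] := eqVneq c 0.
  apply/eqP; rewrite eq_le le sqc0 mul0r dual_sqn_ge0 //.
apply/eqP; rewrite eq_le le /= -ler_pdivlMl ?lt_def ?sqc_ge0 ?sqc_eq0 ?c0 //.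
rewrite -[f in X in X <= _](scalerK c0) -sqcV; exact: le.
Qed.

(* Test [f + g] and [f - g] against [u] and [v] rescaled so that both values
   are real and nonnegative, then regroup [f (u + v) + g (u - v)]. *)
Lemma dual_sqn_par_le f g :
  dual_sqn (f + g) + dual_sqn (f - g) <= 2 * dual_sqn f + 2 * dual_sqn g.
Proof.
have main u v : sqn u <= 1 -> sqn v <= 1 ->
    sqc ((f + g) u) + sqc ((f - g) v) <= 2 * dual_sqn f + 2 * dual_sqn g.
  move=> u1 v1; set a := (f + g) u; set b := (f - g) v.
  pose X := sqc a + sqc b; have X0 : 0 <= X by rewrite addr_ge0 ?sqc_ge0.
  pose u' := a^*%C *: u; pose v' := b^*%C *: v.
  have XE : X%:C%C = f (u' + v') + g (u' - v').
    rewrite rmorphD /= !sqcJ /a /b /u' /v' !dualDr !dualNr !dualZr.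
    by rewrite !dualDE dualNE; move: (_^*%C) => ca; move: (_^*%C) => cb; ring.
  have X2 : X ^+ 2 <= (dual_sqn f + dual_sqn g) * (sqn (u' + v') + sqn (u' -
    v')).
    by rewrite -sqc_real XE sqcD_le ?dual_sqn_ge0 ?sqn_ge0 ?sqc_dual_le.
  have leX : sqn u' + sqn v' <= X.
    by rewrite /u' /v' !sqnZ !sqc_conj lerD // ler_piMr ?sqc_ge0.
  rewrite sqn_par -mulrDr in X2.
  have {}X2 : X ^+ 2 <= (dual_sqn f + dual_sqn g) * (2 * X).
    apply: (le_trans X2); rewrite ler_wpM2l ?addr_ge0 ?dual_sqn_ge0 //.
    by rewrite ler_wpM2l.
  have [X_eq0|X_neq0] := eqVneq X 0.
    by rewrite -/X X_eq0 -mulrDr mulr_ge0 ?addr_ge0 ?dual_sqn_ge0.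
  have X_gt0 : 0 < X by rewrite lt_def X_neq0.
  by rewrite -/X -(ler_pM2r X_gt0) -expr2 (le_trans X2) // le_eqVlt; apply/orP;
    left; apply/eqP; ring.
rewrite -lerBrDr; apply: ge_sup; first exact: (has_sup_dual _).1.
move=> _ [u /= u1 <-]; rewrite lerBrDr addrC -lerBrDr.
apply: ge_sup; first exact: (has_sup_dual _).1.
by move=> _ [v /= v1 <-]; rewrite lerBrDr addrC main.
Qed.

(** The reverse inequality is the previous one for the pair [f + g], [f - g], whose sum and
    difference are [2 f] and [2 g]. *)
Lemma dual_sqn_par f g :
  dual_sqn (f + g) + dual_sqn (f - g) = 2 * dual_sqn f + 2 * dual_sqn g.
Proof.
apply/eqP; rewrite eq_le dual_sqn_par_le /=.
have := dual_sqn_par_le (f + g) (f - g).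
have -> : f + g + (f - g) = 2%:R *: f by rewrite addrACA subrr addr0 scaler_nat
  mulr2n.
have -> : f + g - (f - g) = 2%:R *: g by rewrite opprB (addrC f) addrACA subrr
  addr0 scaler_nat mulr2n.
rewrite !dual_sqnZ sqc_nat; lra.
Qed.

Definition dual_preHilbert : preHilbert R :=
  @PreHilbert R (dual P) dual_sqn dual_sqn_ge0 dual_sqnZ dual_sqn_par.

Lemma dual_sqn_eq0 f : dual_sqn f = 0 -> f = 0.
Proof.
move=> f0; apply/dualP => v; apply/eqP; rewrite -sqc_eq0 eq_le sqc_ge0 andbT.
by rewrite (le_trans (sqc_dual_le f v)) // f0 mul0r.
Qed.

Definition dual_norm f : R[i] := (Num.sqrt (dual_sqn f))%:C%C.

Fact dual_norm_triangle f g : dual_norm (f + g) <= dual_norm f + dual_norm g.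
Proof.
by rewrite /dual_norm -rmorphD lecR (@sqrt_sqnD _ dual_preHilbert f g).
Qed.

Fact dual_normZ c f : dual_norm (c *: f) = `|c| * dual_norm f.
Proof.
by rewrite /dual_norm dual_sqnZ sqrtrM ?sqc_ge0 // rmorphM /= normc_def.
Qed.

Fact dual_norm_eq0 f : dual_norm f = 0 -> f = 0.
Proof.
move=> /complexI/eqP; rewrite sqrtr_eq0 => f0; apply: dual_sqn_eq0.
by apply/eqP; rewrite eq_le f0 dual_sqn_ge0.
Qed.

HB.instance Definition _ := @Lmodule_isNormed.Build R[i] (dual P)
  dual_norm dual_norm_triangle dual_normZ dual_norm_eq0.

Lemma dual_normE f : `|f| = (Num.sqrt (dual_sqn f))%:C%C.
Proof. by []. Qed.

Lemma dual_norm_lt f (e : R) : 0 < e -> `|f| < e%:C%C -> dual_sqn f < e ^+ 2.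
Proof.
move=> e0; rewrite dual_normE ltcR => fe.
by rewrite -(sqr_sqrtr (dual_sqn_ge0 f)) ltr_pXn2r ?nnegrE ?sqrtr_ge0 ?ltW.
Qed.

End DualNorm.

Section DualHilbert.
Variables (R : realType) (P : preHilbert R).
Implicit Types (f g h : dual P) (u v : P) (c : R[i]).

Lemma posC_real (e : R[i]) : 0 < e -> e = (complex.Re e)%:C%C /\ 0 < complex.Re
  e.
Proof.
by case: e => a b; rewrite ltcE /= => /andP[/eqP-> a0]; split.
Qed.

Lemma sqc_le_sqr_eq0 (z : R[i]) (K : R) :
  (forall e : R, 0 < e -> sqc z <= K * e ^+ 2) -> z = 0.
Proof.
move=> zK; apply/eqP; rewrite -sqc_eq0 eq_le sqc_ge0 andbT leNgt; apply/negP =>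
  z0.
have K0 : 0 < K by have := zK 1 ltr01; rewrite expr1n mulr1; exact: lt_le_trans.
pose t := sqc z / (2 * K); have t0 : 0 < t by rewrite divr_gt0 // mulr_gt0.
have := zK (Num.sqrt t); rewrite sqrtr_gt0 => /(_ t0).
rewrite sqr_sqrtr ?(ltW t0) // (_ : K * t = sqc z / 2); last by rewrite /t;
  field; rewrite gt_eqF.
by lra.
Qed.

(** The limit is taken pointwise, separately for real and imaginary parts. The error at [v] is
    controlled by [sqn v] times a factor independent of [v], so the limit is linear and bounded, and
    the convergence holds in the dual norm. *)
Lemma dual_complete (F : set_system (dual P)) : ProperFilter F -> cauchy F ->
  cvg F.
Proof.
move=> FF /cauchyP Fc.
have ptR (p : R[i] -> R) v : (forall z w, p (z - w) = p z - p w) ->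
    (forall z, p z ^+ 2 <= sqc z) ->
    exists x : R, forall (e : R) f, 0 < e -> F (ball f e%:C%C) ->
      (x - p (f v)) ^+ 2 <= e ^+ 2 * sqn v.
  move=> pB p_le; pose s := Num.sqrt (sqn v).
  have s0 : 0 <= s by exact: sqrtr_ge0.
  have near_p (e : R) f g : 0 < e -> ball f e%:C%C g -> `|p (f v) - p (g v)| <=
    e * s.
    move=> e0; rewrite -ball_normE /= => /(dual_norm_lt e0)/ltW le_e.
    rewrite -(@ler_pXn2r _ 2) ?nnegrE ?mulr_ge0 ?(ltW e0) //.
    rewrite real_normK ?num_real // -pB exprMn sqr_sqrtr ?sqn_ge0 //.
    apply: (le_trans (p_le _)); apply: (le_trans (sqc_dual_le (f - g) v)).
    by rewrite ler_wpM2r ?sqn_ge0.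
  have [x Fx] : exists x : R, (fun f : dual P => p (f v)) @ F --> x.
    apply/cvg_ex; apply: (@cauchy_cvg R^o); apply: cauchy_exP => d d0.
    pose e := d / (s + 1); have e0 : 0 < e by rewrite divr_gt0 // ltr_wpDl.
    have [|f Ff] := Fc e%:C%C; first by rewrite ltcR.
    exists (p (f v)); rewrite nbhs_simpl /=; apply: filterS Ff => g /(near_p _
      _ _ e0) le_d.
    rewrite -ball_normE /=; apply: (le_lt_trans le_d).
    rewrite /e mulrAC ltr_pdivrMr ?ltr_wpDl // ltr_pM2l // ltrDl; exact: ltr01.
  exists x => e f e0 Ff; rewrite -[_ ^+ 2]real_normK ?num_real //.
  rewrite -[sqn v]sqr_sqrtr ?sqn_ge0 // -exprMn -/s.
  rewrite ler_pXn2r ?nnegrE ?mulr_ge0 ?(ltW e0) //.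
  apply/ler_addgt0Pr => d d0.
  move/cvgrPdist_lt: Fx => /(_ _ d0) Fxd.
  have [g [/near_p -/(_ e0) g1 g2]] := filter_ex (filterI Ff Fxd).
  rewrite -(subrKA (p (g v))) (le_trans (ler_normD _ _)) // addrC.
  by apply: lerD; [rewrite distrC | exact: ltW].
have pt v : exists z : R[i], forall (e : R) f, 0 < e -> F (ball f e%:C%C) ->
      sqc (z - f v) <= 2 * e ^+ 2 * sqn v.
  have [||x xP] := ptR (@complex.Re R) v; [by case=> [? ?] [] | exact:
    sqr_Re_le |].
  have [||y yP] := ptR (@complex.Im R) v; [by case=> [? ?] [] | exact:
    sqr_Im_le |].
  exists (x +i* y)%C => e f e0 Ff; have := xP e f e0 Ff; have := yP e f e0 Ff.
  by case: (f v) => a b; rewrite /sqc /=; lra.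
have [L LP] := choice pt.
have center (e : R) : 0 < e -> exists f, F (ball f e%:C%C).
  by move=> e0; apply: Fc; rewrite ltcR.
have Llin c u v : L (c *: u + v) = c * L u + L v.
  apply/eqP; rewrite -subr_eq0; apply/eqP.
  pose K := 2 * (2 * sqn (c *: u + v) + 2 * (sqc c * (2 * sqn u) + 2 * sqn v)).
  apply: (@sqc_le_sqr_eq0 _ K) => e e0; have [f Ff] := center e e0.
  have h1 := LP (c *: u + v) e f e0 Ff; have h2 := LP u e f e0 Ff.
  have h3 := LP v e f e0 Ff.
  have -> : L (c *: u + v) - (c * L u + L v) = (L (c *: u + v) - f (c *: u + v))
      + - (c * (L u - f u) + (L v - f v)) by rewrite dual_linear; ring.
  have := sqcD_le2 (L (c *: u + v) - f (c *: u + v)) (- (c * (L u - f u) + (L v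
    - f v))).
  rewrite sqcN; have := sqcD_le2 (c * (L u - f u)) (L v - f v).
  rewrite sqcM; have := ler_wpM2l (sqc_ge0 c) h2.
  by rewrite /K; lra.
have [f1 Ff1] := center 1 ltr01.
have [v|l lE] := @mk_dual R P L (2 * (2 + dual_sqn f1)) Llin.
  have := LP v 1 f1 ltr01 Ff1; have := sqc_dual_le f1 v.
  by have := sqcD_le2 (L v - f1 v) (f1 v); rewrite subrK expr1n; lra.
apply/cvg_ex; exists l; apply/cvgrPdist_le => e /posC_real[-> e0].
set d : R := complex.Re e in e0 *.
(* The pointwise estimate gives [|l - f| <= sqrt 2 * e'], rounded up to [2 * e']; the distance from
   [f] to [g] costs another [e']. *)
pose e' := d / 3; have e'0 : 0 < e' by rewrite divr_gt0.
have [f Ff] := center e' e'0.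
near=> g.
have fg : ball f e'%:C%C g by near: g.
have gl : `|f - g| <= e'%:C%C by move: fg; rewrite -ball_normE => /ltW.
have lf : `|l - f| <= (2 * e')%:C%C.
  have e'2 : 0 <= 2 * e' by lra.
  rewrite dual_normE lecR -(@ler_pXn2r _ 2) ?nnegrE ?sqrtr_ge0 //.
  rewrite sqr_sqrtr ?dual_sqn_ge0 //; apply: dual_sqn_le; first exact: sqr_ge0.
  move=> v; have := LP v e' f e'0 Ff; rewrite -lE.
  rewrite -[(l - f) v]/(l v - f v) => /le_trans; apply.
  apply: ler_wpM2r; first exact: sqn_ge0.
  by have := sqr_ge0 e'; rewrite (exprMn _ 2 e') [2 ^+ 2]expr2; lra.
rewrite /= -[l - _](subrKA f) (le_trans (ler_normD _ _)) // (le_trans (lerD lf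
  gl)) //.
by rewrite -rmorphD lecR /e'; lra.
Unshelve. all: by end_near. Qed.

HB.instance Definition _ := Uniform_isComplete.Build (dual P) dual_complete.

Definition dual_inner f g : R[i] := @polar R (dual_preHilbert P) f g.

Fact dual_inner_bilinear :
  bilinear_for *%R (Num.conj \; *%R) dual_inner.
Proof.
split=> [g a f h|f a g h]; first by rewrite /dual_inner polarDl polarZl.
by rewrite /dual_inner polarDr polarZr.
Qed.

HB.instance Definition _ :=
  @bilinear_isBilinear.Build R[i] (dual P) (dual P) R[i]
    *%R (Num.conj \; *%R) dual_inner dual_inner_bilinear.

Fact dual_inner_hermitian f g :
  dual_inner f g = (-1) ^+ false * Num.conj (dual_inner g f).
Proof. by rewrite expr0 mul1r; exact: polarC. Qed.

HB.instance Definition _ := @isHermitianSesquilinear.Build R[i] (dual P)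
  false Num.conj dual_inner dual_inner_hermitian.

Fact dual_inner_gt0 f : f != 0 -> 0 < dual_inner f f.
Proof.
move=> f0; rewrite /dual_inner polar_self ltcR lt_def dual_sqn_ge0 andbT.
by apply: contra f0 => /eqP/dual_sqn_eq0->.
Qed.

HB.instance Definition _ := @isDotProduct.Build R[i] (dual P) dual_inner
  dual_inner_gt0.

Fact dual_inner_norm f : `|f| ^+ 2 = dual_inner f f.
Proof.
by rewrite /dual_inner polar_self dual_normE -rmorphXn /= sqr_sqrtr
  ?dual_sqn_ge0.
Qed.

Definition dual_hilbert : hilbertSpace R :=
  @HilbertSpace R (dual P) dual_inner dual_inner_norm.

End DualHilbert.

(** * Orthogonal projections and triangular representations *)

Section Projection.
Variables (R : realType) (P : preHilbert R).
Notation H := (dual_preHilbert P).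
Implicit Types (h k m : H).

Variable M : H -> Prop.
Hypothesis M_lin : forall c h k, M h -> M k -> M (c *: h + k).
Hypothesis M0 : M 0.
Hypothesis M_closed : forall h,
  (forall e : R, 0 < e -> exists2 m, M m & sqn (h - m) < e) -> M h.

(** Take [m] whose squared distance to [h] is within [e] of the infimum. Moving [m] by the best
    multiple of [k] lowers this squared distance by [|<h - m, k>|^2 / sqn k], which therefore is at
    most [e]. *)
Lemma almost_orthogonal h (e : R) : 0 < e ->
  exists2 m, M m & forall k, M k -> sqc (polar (h - m) k) <= e * sqn k.
Proof.
move=> e0; pose D := [set sqn (h - m) | m in M].
have D_inf : has_inf D.
  split; first by exists (sqn (h - 0)), 0.
  by exists 0 => _ [m _ <-]; exact: sqn_ge0.
have [_ [m Mm <-] m_lt] := inf_adherent e0 D_inf.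
exists m => // k Mk; have [k0|k0] := eqVneq (sqn k) 0.
  by have := Cauchy_Schwarz (h - m) k; rewrite k0 !mulr0.
have k_gt0 : 0 < sqn k by rewrite lt_def k0 sqn_ge0.
set z := polar _ _; pose c := z * ((sqn k)^-1)%:C%C.
have : inf D <= sqn (h - m - c *: k).
  apply: (ge_inf D_inf.2); exists (c *: k + m); first exact: M_lin.
  by rewrite opprD addrA addrAC.
have cz : c^*%C * z = (sqc z / sqn k)%:C%C.
  have -> : c^*%C = z^*%C * ((sqn k)^-1)%:C%C.
    by rewrite rmorphM; congr (_ * _); exact: conjc_real.
  by rewrite mulrAC [z^*%C * z]mulrC -sqcJ rmorphM.
rewrite sqnD -scaleNr sqnZ sqcN polarZr rmorphN mulNr cz.
rewrite (_ : complex.Re _ = - (sqc z / sqn k)) //.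
have -> : sqc c = sqc z / sqn k ^+ 2 by rewrite sqcM sqc_real exprVn.
have -> : sqc z / sqn k ^+ 2 * sqn k = sqc z / sqn k.
  by rewrite expr2 invfM mulrA divfK.
rewrite -ler_pdivrMr //; lra.
Qed.

(** The difference [k = m - m'] is itself a test vector, and [<k, k>] is the difference of the two
    small products; hence [(sqn k)^2 <= 4 e sqn k]. *)
Lemma almost_orthogonal_dist h m m' (e : R) : 0 < e -> M m -> M m' ->
  (forall k, M k -> sqc (polar (h - m) k) <= e * sqn k) ->
  (forall k, M k -> sqc (polar (h - m') k) <= e * sqn k) ->
  sqn (m - m') <= 4 * e.
Proof.
move=> e0 Mm Mm' om om'; set k := m - m'.
have Mk : M k by rewrite /k addrC -scaleN1r; exact: M_lin.
have : sqc (polar k k) <= 2 * (e * sqn k + e * sqn k).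
  have -> : polar k k = polar (h - m') k + - polar (h - m) k.
    by rewrite -polarBl opprB [h - m' + _]addrC subrKA.
  by apply: (le_trans (sqcD_le2 _ _)); rewrite sqcN ler_pM2l ?lerD ?om ?om'.
rewrite polar_self sqc_real; have [->|k0] := eqVneq (sqn k) 0; first by move=>
  _; rewrite mulr_ge0 // ltW.
have k_gt0 : 0 < sqn k by rewrite lt_def k0 sqn_ge0.
by rewrite -[in X in _ -> X](ler_pM2r k_gt0) expr2; lra.
Qed.

(** Almost orthogonal vectors for errors tending to 0 form a Cauchy sequence, which converges
    because the dual is complete; Cauchy-Schwarz passes orthogonality to the limit. *)
Lemma orthogonal_projection h :
  exists2 m, M m & forall k, M k -> polar (h - m) k = 0.
Proof.
pose e_ (n : nat) : R := n.+1%:R^-1.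
have e_gt0 n : 0 < e_ n by rewrite invr_gt0.
have /choice[m_ m_P] n : exists m, M m /\
    forall k, M k -> sqc (polar (h - m) k) <= e_ n * sqn k.
  by have [m] := almost_orthogonal h (e_gt0 n); exists m.
have e_le n n' : (n <= n')%N -> e_ n' <= e_ n.
  by move=> nn'; rewrite lef_pV2 ?posrE // ler_nat.
have dist n n' : (n <= n')%N -> sqn (m_ n - m_ n') <= 4 * e_ n.
  move=> nn'; apply: (@almost_orthogonal_dist h) => //; try exact: (m_P _).1.
    exact: (m_P _).2.
  move=> k Mk; apply: le_trans ((m_P _).2 _ Mk) _.
  by rewrite ler_wpM2r ?sqn_ge0 ?e_le.
have small (d : R) : 0 < d -> exists N : nat, e_ N < d.
  by move=> d0; exists (Num.truncn d^-1); rewrite invf_plt ?posrE // truncnS_gt.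
have [m m_lim] : exists m : H, (m_ : nat -> dual P) @ \oo --> (m : dual P).
  apply/cvg_ex; apply: cauchy_cvg; apply: cauchy_exP => d /posC_real[-> ].
  set r := complex.Re d => r0.
  have [|N Nr] := small (r ^+ 2 / 4); first by rewrite divr_gt0 ?exprn_gt0.
  exists (m_ N); exists N => // n /= Nn; rewrite -ball_normE /= dual_normE ltcR.
  rewrite -(@ltr_pXn2r _ 2) ?nnegrE ?sqrtr_ge0 ?(ltW r0) //.
  rewrite sqr_sqrtr ?dual_sqn_ge0 //; have := dist _ _ Nn; rewrite /sqn /=; lra.
have m_near (d : R) : 0 < d -> exists n, e_ n < d /\ sqn (m - m_ n) < d.
  move=> d0; have [N Nd] := small d d0.
  have sd0 : 0 < (Num.sqrt d)%:C%C :> R[i] by rewrite ltcR sqrtr_gt0.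
  move/cvgrPdist_lt : m_lim => /(_ _ sd0)[N' _ N'P].
  exists (maxn N N'); split.
    by apply: le_lt_trans Nd; apply: e_le; exact: leq_maxl.
  have := N'P (maxn N N') (leq_maxr _ _); rewrite dual_normE ltcR.
  by rewrite ltr_sqrt.
exists m.
  apply: M_closed => d d0; have [n [_ nd]] := m_near d d0.
  by exists (m_ n) => //; exact: (m_P n).1.
move=> k Mk; apply: (@sqc_le_sqr_eq0 _ _ (4 * sqn k)) => d d0.
have [n [nd md]] := m_near (d ^+ 2) (exprn_gt0 _ d0).
have -> : polar (h - m) k = polar (h - m_ n) k + polar (m_ n - m) k.
  by rewrite -polarDl addrA subrK.
apply: (le_trans (sqcD_le2 _ _)).
have h1 := (m_P n).2 k Mk; have h2 := Cauchy_Schwarz (m_ n - m) k.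
have k0 := sqn_ge0 k; rewrite sqnBC in h2.
have h3 := ler_wpM2r k0 (ltW nd); have h4 := ler_wpM2r k0 (ltW md).
lra.
Qed.

End Projection.

Section Intertwining.
Variables (R : realType) (P : preHilbert R).
Notation H := (dual_hilbert P).
Implicit Types (h k : dual P).

Lemma bounded_operator_sqn (S : {linear H -> H}) : bounded_operator S ->
  exists C : R, forall h, dual_sqn (S h : dual P) <= C * dual_sqn h.
Proof.
rewrite /bounded_operator => S_fin.
have [C CE] : exists C : R, (opnorm S <= C%:E)%E.
  case: (opnorm S) S_fin => [r _|//|_]; first by exists r.
  by exists 0; rewrite leNye.
exists (C ^+ 2) => h; have C1 (g : dual P) : dual_sqn g <= 1 ->
    dual_sqn (S g : dual P) <= C ^+ 2.
  move=> g1; have SgC : Num.sqrt (dual_sqn (S g : dual P)) <= C.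
    rewrite -lee_fin; apply: (le_trans _ CE); apply: ereal_sup_ubound.
    exists (g : H) => //=; rewrite dual_normE -(rmorph1 (real_complex R)) lecR.
    by rewrite -sqrtr1 ler_wsqrtr.
  rewrite -(sqr_sqrtr (dual_sqn_ge0 (S g : dual P))).
  by rewrite ler_pXn2r ?nnegrE ?sqrtr_ge0 // (le_trans _ SgC) ?sqrtr_ge0.
have [h0|h0] := eqVneq (dual_sqn h) 0.
  rewrite (dual_sqn_eq0 h0) (_ : S _ = 0); last exact: linear0.
  by rewrite -[dual_sqn _]/(@sqn R (dual_preHilbert P) 0) sqn0 mulr0.
have h_gt0 : 0 < dual_sqn h by rewrite lt_def h0 dual_sqn_ge0.
pose c : R[i] := ((Num.sqrt (dual_sqn h))^-1)%:C%C.
have cE : sqc c = (dual_sqn h)^-1 by rewrite sqc_real exprVn sqr_sqrtr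
  ?dual_sqn_ge0.
have := C1 (c *: h); rewrite dual_sqnZ cE mulVf // => /(_ (lexx _)).
rewrite (_ : S _ = c *: (S h : dual P)); last exact: linearZ.
by rewrite dual_sqnZ cE mulrC ler_pdivrMr.
Qed.

Lemma opnorm_le (S : {linear H -> H}) (C : R) : 0 <= C ->
  (forall h, dual_sqn (S h : dual P) <= C ^+ 2 * dual_sqn h) ->
  (opnorm S <= C%:E)%E.
Proof.
move=> C0 SC; apply: ge_ereal_sup => _ [h /= h1 <-].
rewrite lee_fin /= -(@ler_pXn2r _ 2) ?nnegrE ?sqrtr_ge0 //.
rewrite sqr_sqrtr ?dual_sqn_ge0 //; apply: (le_trans (SC h)).
rewrite ler_piMr ?sqr_ge0 //; move: h1.
rewrite dual_normE -(rmorph1 (real_complex R)) lecR -{1}sqrtr1.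
by rewrite ler_sqrt.
Qed.

Variables (G : groupType) (pi : G -> {linear H -> H}).
Variable N : dual P -> Prop.
Hypothesis N_lin : forall c h k, N h -> N k -> N (c *: h + k).
Hypothesis N0 : N 0.
Hypothesis N_closed : forall h,
  (forall e : R, 0 < e -> exists2 m, N m & dual_sqn (h - m) < e) -> N h.
Hypothesis N_stable : forall t h, N h -> N (pi t h).
Hypothesis pi_rep : representation pi.

(** The similarity [S] turns [<S' h, S' k>] into an inner product, equivalent to the original one,
    that [pi] preserves. The projection onto [N] orthogonal for this product commutes with [pi],
    because both [N] and the product are invariant. *)
Lemma intertwining_projection : unitarizable_representation pi ->
  exists (Q : dual P -> dual P) (C : R),
  [/\ forall h, N (Q h), forall h, N h -> Q h = h,
      forall c h k, Q (c *: h + k) = c *: Q h + Q k,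
      forall t h, Q (pi t h) = pi t (Q h) &
      forall h, dual_sqn (Q h) <= C * dual_sqn h].
Proof.
case=> S [S' [Sb S'b SK S'K [_ unit]]].
have [CS SC] := bounded_operator_sqn Sb.
have [CS' S'C] := bounded_operator_sqn S'b.
have [_ pi1 piM] := pi_rep.
pose M (h : dual_preHilbert P) := N (S h).
have M_lin c (h k : dual_preHilbert P) : M h -> M k -> M (c *: h + k).
  move=> Mh Mk; rewrite /M (_ : S _ = c *: (S h : dual P) + (S k : dual P)).
    exact: N_lin.
  exact: linearP.
have M0 : M 0 by rewrite /M (_ : S _ = 0) //; exact: linear0.
have M_closed (h : dual_preHilbert P) :
    (forall e : R, 0 < e -> exists2 m, M m & sqn (h - m) < e) -> M h.
  move=> h_lim; apply: N_closed => e e0.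
  have C1 : 0 < `|CS| + 1 by rewrite ltr_wpDl.
  have [m Mm hm] := h_lim (e / (`|CS| + 1)) (divr_gt0 e0 C1).
  exists (S m) => //; rewrite (_ : _ - _ = S (h - m : dual P) :> dual P).
    apply: (le_lt_trans (SC _)); rewrite ltr_pdivlMr // mulrC in hm.
    apply: le_lt_trans hm; rewrite ler_wpM2r ?dual_sqn_ge0 //.
    by rewrite (le_trans (ler_norm _)) // lerDl.
  by apply/esym; exact: linearB.
have /choice[p p_P] (h : dual_preHilbert P) : exists m, M m /\
    forall k, M k -> polar (h - m) k = 0.
  by have [m] := orthogonal_projection M_lin M0 M_closed h; exists m.
pose Q (h : dual P) : dual P := S (p (S' h)).
pose ip (h k : dual P) := @polar R (dual_preHilbert P) (S' h) (S' k).
have S'D c h k : S' (c *: h + k) = c *: (S' h : dual P) + (S' k : dual P).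
  exact: linearP.
have ipl c h h' k : ip (c *: h + h') k = c * ip h k + ip h' k.
  by rewrite /ip S'D polarDl polarZl.
have ipB h h' k : ip (h - h') k = ip h k - ip h' k.
  by rewrite addrC -scaleN1r ipl mulN1r addrC.
have NQ h : N (Q h) by exact: (p_P _).1.
have oQ h k : N k -> ip (h - Q h) k = 0.
  move=> Nk; rewrite ipB /ip /Q SK -polarBl; apply: (p_P _).2.
  by rewrite /M S'K.
(* Uniqueness of the projection: that [Q] fixes [N], is linear and commutes with [pi] will each
   follow by checking that a candidate is in [N] with orthogonal remainder. *)
have uQ h q : N q -> (forall k, N k -> ip (h - q) k = 0) -> Q h = q.
  move=> Nq oq; pose k := Q h - q.
  have Nk : N k by rewrite /k addrC -scaleN1r; exact: N_lin.
  have : ip k k = 0.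
    have -> : ip k k = ip (h - q) k - ip (h - Q h) k.
      by rewrite -ipB opprB [h - q + _]addrC subrKA.
    by rewrite oq // oQ // subrr.
  rewrite /ip polar_self => /complexI/dual_sqn_eq0 S'k0.
  have : S (S' k) = S (0 : dual P) by rewrite S'k0.
  rewrite S'K (_ : S _ = 0); last exact: linear0.
  by move=> /eqP; rewrite subr_eq0 => /eqP.
have ip_pi t h k : ip (pi t h) (pi t k) = ip h k.
  have [_ /(_ (S' h) (S' k)) /=] := unit t.
  by rewrite !S'K.
have piK t h : pi t (pi t^-1%g h) = h by rewrite -piM mulgV pi1.
exists Q, (`|CS| * CS'); split=> //.
- move=> h Nh; apply: uQ => // k Nk.
  by rewrite subrr -(subrr 0) ipB subrr.
- move=> c h k; apply: uQ => [|l Nl]; first exact: N_lin.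
  rewrite opprD addrACA -scalerBr ipl !oQ //.
  by rewrite mulr0 addr0.
- move=> t h; apply: uQ => [|k Nk]; first exact: N_stable.
  rewrite -(piK t k) -[pi t h - _](_ : pi t (h - Q h : dual P) = _).
    by rewrite ip_pi oQ //; exact: N_stable.
  exact: linearB.
move=> h; set x : dual_preHilbert P := S' h.
have px_le : dual_sqn (p x) <= dual_sqn x.
  have /= := sqnD (x - p x) (p x); rewrite subrK (p_P x).2; last exact: (p_P
    x).1.
  rewrite /= mulr0 addr0 => ->.
  by rewrite lerDr dual_sqn_ge0.
apply: (le_trans (SC _)); apply: (@le_trans _ _ (`|CS| * dual_sqn (p x))).
  by rewrite ler_wpM2r ?dual_sqn_ge0 ?ler_norm.
rewrite -mulrA ler_wpM2l //; exact: (le_trans px_le (S'C h)).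
Qed.

End Intertwining.

Section TriangularRepresentation.
Variables (R : realType) (W : groupType) (P : preHilbert R).
Implicit Types (u v : P) (w : W).
Variables (L D : W -> P -> P).

Hypothesis L_lin : forall w c u v, L w (c *: u + v) = c *: L w u + L w v.
Hypothesis L1 : forall u, L 1%g u = u.
Hypothesis LM : forall w w' u, L (w * w')%g u = L w (L w' u).
Hypothesis L_isom : forall w u, sqn (L w u) = sqn u.
Hypothesis D_lin : forall w c u v, D w (c *: u + v) = c *: D w u + D w v.
Hypothesis DM : forall w w' u, D (w * w')%g u = L w (D w' u) + D w (L w' u).
Variable K : R.
Hypothesis D_le : forall w u, sqn (D w u) <= K * sqn u.

Notation V := (prod_preHilbert P P).

Definition triangular w (x : V) : V := (L w x.1 + D w x.2, L w x.2).

Fact triangular_lin w c (x y : V) :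
  triangular w (c *: x + y) = c *: triangular w x + triangular w y.
Proof.
congr pair; rewrite /= ?L_lin ?D_lin //=.
by rewrite scalerDr addrACA.
Qed.

Fact triangular_le w (x : V) : sqn (triangular w x) <= (3 + 2 * `|K|) * sqn x.
Proof.
have := sqnD_le2 (L w x.1) (D w x.2); have := D_le w x.2.
have := ler_wpM2r (sqn_ge0 x.2) (ler_norm K).
have := sqn_ge0 x.1; have := sqn_ge0 x.2.
have := mulr_ge0 (normr_ge0 K) (sqn_ge0 x.1).
by rewrite !prod_sqnE /= !L_isom; lra.
Qed.

Let L0 w : L w 0 = 0.
Proof. by have := L_lin w (-1) 0 0; rewrite scaler0 addr0 scaleN1r addNr. Qed.

Let D0 w : D w 0 = 0.
Proof. by have := D_lin w (-1) 0 0; rewrite scaler0 addr0 scaleN1r addNr. Qed.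

Let LD w u v : L w (u + v) = L w u + L w v.
Proof. by rewrite -[u in LHS]scale1r L_lin scale1r. Qed.

Let LN w u : L w (- u) = - L w u.
Proof. by apply/eqP; rewrite -addr_eq0 -LD addNr L0. Qed.

Lemma polar_L w u v : polar (L w u) (L w v) = polar u v.
Proof.
have rpL u' v' : repolar (L w u') (L w v') = repolar u' v'.
  by rewrite /repolar -LN -!LD !L_isom.
rewrite polar.unlock rpL; congr Complex; rewrite -[RHS]rpL; congr repolar.
by have := L_lin w 'i%C v 0; rewrite L0 !addr0 => ->.
Qed.

Lemma L_VK w u : L w^-1%g (L w u) = u.
Proof. by rewrite -LM mulVg L1. Qed.

Fact contragredient_subproof w (h : dual V) :
  (fun x => h (triangular w^-1%g x)) \in @dual_pred R V.
Proof.
apply/asboolP; split=> [c x y|]; first by rewrite triangular_lin dual_linear.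
exists (dual_sqn h * (3 + 2 * `|K|)) => x.
apply: (le_trans (sqc_dual_le _ _)); rewrite -mulrA.
by rewrite ler_wpM2l ?dual_sqn_ge0 ?triangular_le.
Qed.

Definition contragredient w (h : dual_hilbert V) : dual_hilbert V :=
  Dual (contragredient_subproof w h).

Fact contragredient_linear w : linear (contragredient w).
Proof. by move=> c h k; apply/dualP => x. Qed.

HB.instance Definition _ w := GRing.isLinear.Build R[i]
  (dual_hilbert V) (dual_hilbert V) *:%R (contragredient w)
  (contragredient_linear w).

Notation pi := (fun w => contragredient w : {linear dual_hilbert V ->
  dual_hilbert V}).

Lemma contragredient_le w (h : dual V) :
  dual_sqn (contragredient w h : dual V) <= (3 + 2 * `|K|) * dual_sqn h.
Proof.
apply: dual_sqn_le => [|x]; first by rewrite mulr_ge0 ?dual_sqn_ge0 ?addr_ge0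
  ?mulr_ge0.
apply: (le_trans (sqc_dual_le h _)).
by rewrite [X in _ <= X]mulrAC mulrC ler_wpM2r ?dual_sqn_ge0 ?triangular_le.
Qed.

Lemma contragredient_opnorm w :
  (opnorm (pi w) <= (Num.sqrt (3 + 2 * `|K|))%:E)%E.
Proof.
apply: opnorm_le => [|h]; first exact: sqrtr_ge0.
by rewrite sqr_sqrtr ?addr_ge0 ?mulr_ge0 ?contragredient_le.
Qed.

Lemma contragredient_rep : representation pi.
Proof.
split=> [w|h|w w' h].
- exact: le_lt_trans (contragredient_opnorm w) (ltry _).
- apply/dualP => x /=; rewrite invg1; congr (h _).
  have D1 u : D 1%g u = 0.
    have := DM 1%g 1%g u; rewrite mulg1 !L1 => /eqP.
    by rewrite -subr_eq0 opprD addNKr oppr_eq0 => /eqP.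
  by rewrite /triangular !L1 D1 addr0; case: x.
apply/dualP => x /=; congr (h _).
rewrite invgM /triangular /= !LM DM; congr pair.
by rewrite LD addrA.
Qed.

Lemma contragredient_ub : uniformly_bounded pi.
Proof.
apply: (@le_lt_trans _ _ (Num.sqrt (3 + 2 * `|K|))%:E); last exact: ltry.
by apply: ge_ereal_sup => _ [w _ <-]; exact: contragredient_opnorm.
Qed.

(* [B] measures the failure of [D] to be inner: if [D w = T L w - L w T] with
   [T] bounded, then [B u v] is [<T u, v>]. *)
Lemma unitarizable_triangular : unitarizable R W ->
  exists (B : P -> P -> R[i]) (C : R),
  [/\ forall c u u' v, B (c *: u + u') v = c * B u v + B u' v,
      forall c u v v', B u (c *: v + v') = c^*%C * B u v + B u v',
      forall u v, sqc (B u v) <= C * (sqn u * sqn v) &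
      forall w u v, B u v = B (L w u) (L w v) + polar (D w^-1%g (L w u)) v].
Proof.
move=> /(_ _ _ contragredient_rep contragredient_ub).
(* The annihilator of the first summand, which [triangular] preserves, is invariant under the
   contragredient; it consists of the functionals of the second coordinate. *)
pose N (h : dual V) := forall u, h (u, 0) = 0.
have N_lin c h k : N h -> N k -> N (c *: h + k).
  by move=> Nh Nk u; rewrite dualDE dualZE Nh Nk mulr0 addr0.
have N0 : N 0 by [].
have N_closed h : (forall e : R, 0 < e -> exists2 m, N m & dual_sqn (h - m) <
  e) -> N h.
  move=> h_lim u; apply: (@sqc_le_sqr_eq0 _ _ (sqn u)) => e e0.
  have [m Nm hm] := h_lim (e ^+ 2) (exprn_gt0 _ e0).
  have -> : h (u, 0) = (h - m) (u, 0) by rewrite dualDE dualNE Nm subr0.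
  apply: (le_trans (sqc_dual_le _ _)).
  have -> : @sqn R V (u, 0) = sqn u by rewrite prod_sqnE /= sqn0 addr0.
  by rewrite mulrC ler_wpM2l ?sqn_ge0 ?ltW.
have N_stable w h : N h -> N (contragredient w h).
  by move=> Nh u; rewrite /= /triangular /= D0 L0 addr0 Nh.
case/(intertwining_projection N_lin N0 N_closed N_stable contragredient_rep).
move=> Q [C [NQ QN Q_lin Q_pi Q_le]].
have /choice[l lE] v : exists l : dual V, forall x, l x = polar x.1 v.
  have [c x y|x|l lE] := @mk_dual R V (fun x => polar x.1 v) (sqn v).
  - by rewrite /= polarDl polarZl.
  - apply: (le_trans (Cauchy_Schwarz _ _)); rewrite mulrC ler_wpM2l ?sqn_ge0 //.
    by rewrite prod_sqnE lerDl sqn_ge0.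
  by exists l => x; rewrite lE.
have l_le v : dual_sqn (l v) <= sqn v.
  apply: dual_sqn_le => [|x]; rewrite ?sqn_ge0 // lE.
  apply: (le_trans (Cauchy_Schwarz _ _)); rewrite mulrC ler_wpM2l ?sqn_ge0 //.
  by rewrite prod_sqnE lerDl sqn_ge0.
pose B u v := Q (l v) (0, u).
exists B, `|C|; split.
- move=> c u u' v; rewrite /B -dual_linear; congr (Q _ _); congr pair.
  by rewrite /= scaler0 addr0.
- move=> c u v v'; rewrite /B -dualZE -dualDE -Q_lin; congr (Q _ _).
  by apply/dualP => x; rewrite dualDE dualZE !lE polarDr polarZr.
- move=> u v; apply: (le_trans (sqc_dual_le _ _)).
  have -> : @sqn R V (0, u) = sqn u by rewrite prod_sqnE /= sqn0 add0r.
  rewrite mulrCA mulrC ler_wpM2l ?sqn_ge0 //.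
  apply: (le_trans (Q_le _)); apply: (@le_trans _ _ (`|C| * dual_sqn (l v))).
    by rewrite ler_wpM2r ?dual_sqn_ge0 ?ler_norm.
  by rewrite ler_wpM2l.
(* [k] measures how far [l] is from commuting with the group. It depends on the second coordinate
   only, so [Q] fixes it; applying [Q] and evaluating at [(0, L w u)] yields the identity for
   [B]. *)
move=> w u v; pose k : dual V := contragredient w (l v) - l (L w v).
have kE x : k x = polar (D w^-1%g x.2) v.
  rewrite dualDE dualNE /= !lE /= polarDl addrAC -(polar_L w (L _ _)) -LM.
  by rewrite mulgV L1 subrr add0r.
have Nk : N k by move=> u'; rewrite kE /= D0 polar0l.
have Qk : Q (contragredient w (l v)) = k + Q (l (L w v)).
  rewrite -[in RHS](QN k Nk) -[Q k]scale1r -Q_lin scale1r; congr Q.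
  by rewrite /k subrK.
have := congr1 (fun h : dual V => h (0, L w u)) Qk.
have Q_snd a b : Q (l v) (a, b) = B b v.
  have -> : (a, b) = (a, 0) + (0, b) :> V by congr pair; rewrite /= ?addr0
    ?add0r.
  by rewrite dualDr NQ add0r.
by rewrite Q_pi dualDE kE /= /triangular /= Q_snd L_VK addrC.
Qed.

End TriangularRepresentation.

(** * Ping-pong in the free group *)

Section PingPong.

Let hd (s : F2) := ohead (word s).
Let a : F2 := @FreeGroup bool [:: (true, true)] isT.
Let b : F2 := @FreeGroup bool [:: (false, true)] isT.

Fact hd_mulg (x : letter bool) (s : F2) : hd s != Some (letterV x) ->
  hd (@FreeGroup bool [:: x] isT * s)%g = Some x.
Proof.
case: s => -[//|y s] rs; rewrite /hd /=; have [->|//] := eqVneq y (letterV x).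
by rewrite eqxx.
Qed.

Fact hd_expg n (s : F2) : hd s != Some (true, false) ->
  hd (a ^+ n.+1 * s)%g = Some (true, true).
Proof.
move=> hs; elim: n => [|n IHn]; first by rewrite expg1 hd_mulg.
by rewrite expgS -mulgA hd_mulg // IHn.
Qed.

Fact hd_expg_inj i j (s : F2) (e e' : bool) :
  hd (a ^+ i * s)%g = Some (false, e) -> hd (a ^+ j * s)%g = Some (false, e') ->
  i = j.
Proof.
wlog ij : i j e e' / (i <= j)%N => [W|].
  by case/orP: (leq_total i j) => ij hi hj; [|apply/esym]; apply: W hi hj ||
    apply: W hj hi.
move=> hi; rewrite -(subnK ij); case: (j - i)%N => [//|n].
by rewrite expgnDr -mulgA hd_expg // hi.
Qed.

(* With [x = a^-1] and [y = b^-1] the standard generators, [g i = x^i y x^-i]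
   and [L i] is the set of [s] such that the reduced word of [x^-i s] begins by
   [y^-1]; multiplying by a further power of [x] then produces a word starting
   with [x] or [x^-1], whence disjointness. *)
Lemma F2_ping_pong : exists (g : nat -> F2) (L : nat -> F2 -> bool),
  [/\ forall i j s, L i s -> L j s -> i = j,
      forall i j s, ~~ L i ((g i)^-1 * s)%g -> ~~ L j ((g j)^-1 * s)%g -> i = j,
      forall i, ~~ L i 1%g &
      forall i, L i (g i)^-1%g].
Proof.
pose g i : F2 := (a ^- i * b^-1 * a ^+ i)%g.
pose L i s := hd (a ^+ i * s)%g == Some (false, true).
have gV i s : (a ^+ i * ((g i)^-1 * s) = b * (a ^+ i * s))%g.
  by rewrite /g !invgM !invgK !mulgA mulgV mul1g.
have hd_a i : hd (a ^+ i * 1)%g != Some (false, false) /\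
    hd (a ^+ i * 1)%g != Some (false, true).
  case: i => [|i]; first by rewrite expg0 mulg1.
  by rewrite hd_expg.
exists g, L; split=> [i j s|i j s|i|i].
- by move=> /eqP hi /eqP hj; apply: hd_expg_inj hi hj.
(* By [gV], [a ^+ k * ((g k)^-1 * s)] is [b] times [a ^+ k * s]; it begins with the letter of [b],
   contrary to [h], unless the first letter of [a ^+ k * s] cancels it. *)
- have L' k : ~~ L k ((g k)^-1 * s)%g -> hd (a ^+ k * s)%g = Some (false,
  false).
    rewrite /L gV => h; apply/eqP; apply: contraNT h => h.
    by rewrite hd_mulg.
  by move=> /L' hi /L' hj; apply: hd_expg_inj hi hj.
- by have [] := hd_a i.
rewrite /L -[(g i)^-1%g]mulg1 gV hd_mulg //; exact: (hd_a i).1.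
Qed.

End PingPong.

Lemma F2_countable : countable [set: F2].
Proof.
pose f (s : F2) : nat := choice.pickle (word s : seq (bool * bool)).
apply/pcard_injP; exists f => s t _ _ /(pcan_inj choice.pickleK) st.
exact: val_inj.
Qed.

(** * Characters of infinite abelian groups *)

Section Characters.
Variables (R : realType) (A : groupType).
Hypothesis A_abelian : forall x y : A, commute x y.
Notation C := R[i].
Implicit Types (S : set (A * C)) (x y h : A) (z c : C).

Definition character (chi : A -> C) : Prop :=
  (forall x y, chi (x * y)%g = chi x * chi y) /\ forall x, sqc (chi x) = 1.

(* Graphs of unimodular characters of subgroups of [A]. *)
Definition partial_character S : Prop :=
  [/\ S (1%g, 1),
      forall x y c d, S (x, c) -> S (y, d) -> S ((x * y)%g, c * d),
      forall x c, S (x, c) -> S (x^-1%g, c^-1),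
      forall x c, S (x, c) -> sqc c = 1 &
      forall c, S (1%g, c) -> c = 1].

Lemma unimodular_neq0 z : sqc z = 1 -> z != 0.
Proof. by move=> z1; rewrite -sqc_eq0 z1 oner_eq0. Qed.

Let mulC x y : (x * y = y * x)%g.
Proof. exact: A_abelian. Qed.

Let mulACA x y x' y' : (x * y * (x' * y') = (x * x') * (y * y'))%g.
Proof. by rewrite -mulgA (mulgA y) (mulC y x') -!mulgA. Qed.

Lemma partial_character_fun S x c d : partial_character S ->
  S (x, c) -> S (x, d) -> c = d.
Proof.
case=> _ SM SV S1 S_inj Sc Sd; have := SM _ _ _ _ Sc (SV _ _ Sd).
rewrite mulgV => /S_inj /divr1_eq //.
Qed.

(** The graph of the extension that sends [x] to [z]. An integer power of [x] is written as a
    quotient of two natural powers, kept on either side of the equations. *)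
Definition extension S x z : set (A * C) :=
  [set p | exists h c m n, [/\ S (h, c), (p.1 * x ^+ m = h * x ^+ n)%g &
                               p.2 * z ^+ m = c * z ^+ n]].

Lemma extension_partial S x z : partial_character S -> sqc z = 1 ->
  (forall n c, S ((x ^+ n)%g, c) -> c = z ^+ n) ->
  [/\ partial_character (extension S x z), S `<=` extension S x z &
      extension S x z (x, z)].
Proof.
move=> [S1 SM SV Su S_inj] z1 Sz; split.
- have z0 n : z ^+ n != 0 by rewrite expf_neq0 ?unimodular_neq0.
  have zu n : sqc (z ^+ n) = 1 by rewrite sqcX z1 expr1n.
  split.
  + by exists 1%g, 1, 0%N, 0%N.
  + move=> y y' w w' [h [c [m [n [Shc /= yE wE]]]]] [h' [c' [m' [n' [Shc' /=
    yE' wE']]]]].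
    exists (h * h')%g, (c * c'), (m + m')%N, (n + n')%N; split=> /=.
    * exact: SM.
    * by rewrite !expgnDr mulACA yE yE' mulACA.
    * by rewrite !exprD mulrACA wE wE' mulrACA.
  + move=> y w [h [c [m [n [Shc /= yE wE]]]]].
    exists h^-1%g, c^-1, n, m; split=> /=; first exact: SV.
      apply: (mulgI y); apply: (mulgI h); rewrite mulVKg.
      rewrite (mulC y) mulgA mulVKg.
      by rewrite -yE -(mulC (x ^+ m)%g).
    have w0 : w != 0.
      apply/eqP => w0; move: wE; rewrite w0 mul0r => /esym/eqP.
      by rewrite mulf_eq0 (negPf (z0 n)) (negPf (unimodular_neq0 (Su _ _ Shc))).
    apply: (mulfI w0); apply: (mulfI (unimodular_neq0 (Su _ _ Shc))).
    rewrite mulVKf // [w * _]mulrCA mulVKf ?unimodular_neq0 ?(Su _ _ Shc) //.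
  + move=> y w [h [c [m [n [Shc /= yE wE]]]]].
    by have := congr1 (@sqc R) wE; rewrite !sqcM !zu (Su _ _ Shc) !mulr1.
  (* Over the unit, [h * x ^+ n = x ^+ m], so [h] or its inverse is a natural power of [x], on which
     [S] already agrees with the powers of [z]. *)
  move=> w [h [c [m [n [Shc /= xE wE]]]]]; rewrite mul1g in xE.
  apply: (mulIf (z0 m)); rewrite mul1r wE.
  have [nm|mn] := leqP n m.
    have hE : h = (x ^+ (m - n))%g by apply: (mulIg (x ^+ n)%g); rewrite
      -expgnDr subnK // xE.
    by rewrite hE in Shc; rewrite (Sz _ _ Shc) -exprD subnK.
  have hE : (h^-1 = x ^+ (n - m))%g.
    apply: (mulgI h); apply: (mulIg (x ^+ m)%g).
    by rewrite mulgV mul1g -mulgA -expgnDr subnK // ltnW.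
  have := SV _ _ Shc; rewrite hE => /Sz cE.
  rewrite -[n in z ^+ n](subnK (ltnW mn)) exprD -cE mulVKf //.
  exact: unimodular_neq0 (Su _ _ Shc).
- by move=> [y c] Syc; exists y, c, 0%N, 0%N; rewrite /= !expg0 !expr0 !mulg1
  !mulr1.
by exists 1%g, 1, 0%N, 1%N; rewrite /= !expg0 !expr0 !mulg1 !mulr1 mul1g mul1r.
Qed.

(** In the second case [k] is the least positive exponent with [x ^+ k] in the domain of [S]. By
    Euclidean division all such exponents are multiples of [k], so every [k]-th root of the value
    [c] is a consistent value at [x]. *)
Lemma order_in_partial S x : partial_character S ->
  (forall n c, S ((x ^+ n.+1)%g, c) -> False) \/
  exists k c, [/\ (0 < k)%N, S ((x ^+ k)%g, c) &
    forall z n d, z ^+ k = c -> S ((x ^+ n)%g, d) -> d = z ^+ n].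
Proof.
move=> SP; have [S1 SM SV Su S_inj] := SP.
have [[n [c Sn]]|h] := pselect (exists n c, S ((x ^+ n.+1)%g, c)); last first.
  by left=> n c Sn; apply: h; exists n, c.
right; have ex : exists k, `[< (0 < k)%N /\ exists c, S ((x ^+ k)%g, c) >].
  by exists n.+1; apply/asboolP; split=> //; exists c.
have [k /asboolP[k0 [d Sk]] k_min] := ex_minnP ex; exists k, d; split=> // z m
  e zk Sm.
have SX j : S ((x ^+ (k * j))%g, d ^+ j).
  elim: j => [|j IHj]; first by rewrite muln0.
  by rewrite mulnS expgnDr exprS; exact: SM.
have := SM _ _ _ _ Sm (SV _ _ (SX (m %/ k)%N)).
rewrite -expgnFr; last by rewrite mulnC leq_trunc_div.
have -> : (m - k * (m %/ k) = m %% k)%N by rewrite {1}(divn_eq m k) mulnC addKn.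
have [r0|r_gt0] := posnP (m %% k)%N.
  rewrite r0 => /S_inj /divr1_eq ->.
  by rewrite -zk -exprM mulnC divnK // /dvdn r0.
move=> Sr; have /k_min : `[< (0 < m %% k)%N /\ exists c, S ((x ^+ (m %% k))%g,
  c) >].
  by apply/asboolP; split=> //; eexists; exact: Sr.
by rewrite leqNgt ltn_pmod.
Qed.

Lemma extension_value S x : partial_character S ->
  exists2 z, sqc z = 1 & forall n c, S ((x ^+ n)%g, c) -> c = z ^+ n.
Proof.
move=> SP; have [_ _ _ Su S_inj] := SP.
case: (order_in_partial x SP) => [noS|[k [c [k0 Sk zP]]]].
  exists 1; first exact: sqc1.
  by case=> [|n] c; [rewrite expg0 expr0; exact: S_inj | move=> /noS].
exists (k.-root c); last by move=> n d; apply: zP; exact: rootCK.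
apply/eqP; rewrite -(@pexpr_eq1 _ _ k) ?sqc_ge0 // -sqcX rootCK //.
by rewrite (Su _ _ Sk).
Qed.

(** Any root of [1 + X + ... + X^(k-1)] will do: at 1 this polynomial takes the nonzero value
    [k]. *)
Lemma nontrivial_root_of_unity k : (1 < k)%N ->
  exists2 z : C, z != 1 & z ^+ k = 1.
Proof.
move=> k1; pose p : {poly C} := \poly_(i < k) 1.
have p_size : size p = k by rewrite size_poly_eq // oner_neq0.
have [z /rootP pz] : exists z, root p z by apply/closed_rootP; rewrite p_size
  gtn_eqF.
have pE (y : C) : p.[y] = \sum_(i < k) y ^+ i.
  by rewrite horner_poly; apply: eq_bigr => i _; rewrite mul1r.
exists z; last first.
  by apply/eqP; rewrite -subr_eq0 subrX1 -pE pz mulr0.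
apply: contra_eq_neq pz => ->; rewrite pE.
under eq_bigr do rewrite expr1n.
rewrite sumr_const card_ord pnatr_eq0; lia.
Qed.

(** Extend the trivial character of the trivial subgroup: [a] goes to -1 if it has infinite order,
    and otherwise to a nontrivial root of unity whose exponent is the order of [a]. *)
Lemma nontrivial_partial_character a : a != 1%g ->
  exists S z, [/\ partial_character S, S (a, z) & z != 1].
Proof.
move=> a1; pose S0 : set (A * C) := [set p | p = (1%g, 1)].
have S0P : partial_character S0.
  split=> //.
  - by move=> x y c d [-> ->] [-> ->]; rewrite /S0 /= mulg1 mulr1.
  - by move=> x c [-> ->]; rewrite /S0 /= invg1 invr1.
  - by move=> x c [_ ->]; rewrite sqc1.
  - by move=> c [->].
have [z [zu z1 zP]] : exists z, [/\ sqc z = 1, z != 1 &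
    forall n c, S0 ((a ^+ n)%g, c) -> c = z ^+ n].
  case: (order_in_partial a S0P) => [noS|[k [c [k0 [ak ck] zP]]]].
    exists (-1); rewrite sqcN sqc1; split=> //.
      by rewrite eq_sym -addr_eq0 -(natrD _ 1 1) pnatr_eq0.
    by case=> [|n] c; [move=> /(congr1 snd) /= ->; rewrite expr0 | move=> /noS].
  have [|z z1 zk] := @nontrivial_root_of_unity k.
    by case: k k0 ak {zP} => [|[|k]] // _; rewrite expg1 => /eqP; rewrite
      (negPf a1).
  exists z; split=> // [|n d]; last by apply: zP; rewrite zk ck.
  have := congr1 (@sqc R) zk; rewrite sqc1 => zk1; apply/eqP.
  by rewrite -(@pexpr_eq1 _ _ k) ?sqc_ge0 // -zk1 sqcX.
have [S1 _ S2] := extension_partial S0P zu zP.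
by exists (extension S0 a z), z; split.
Qed.

Lemma separating_character a : a != 1%g ->
  exists2 chi, character chi & chi a != 1.
Proof.
move=> /nontrivial_partial_character[B [w [BP Baw w1]]].
(* Zorn's lemma is applied to the sets [X] to be added to [B]: the empty chain then causes no
   trouble, and the maximal graph contains [B]. *)
pose P (X : set (A * C)) := partial_character (B `|` X).
have [F FP Ftot|M [MP M_max]] := @Zorn_bigcup _ P.
  have pick p q : (B `|` \bigcup_(X in F) X) p -> (B `|` \bigcup_(X in F) X) q
    ->
      exists X, [/\ partial_character X, X p, X q &
        X `<=` B `|` \bigcup_(X in F) X].
    move=> [Bp|[X FX Xp]] [Bq|[Y FY Yq]].
    - by exists B; split=> // x Bx; left.
    - exists (B `|` Y); split; [exact: FP | by left | by right |].
      by move=> x [Bx|Yx]; [left | right; exists Y].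
    - exists (B `|` X); split; [exact: FP | by right | by left |].
      by move=> x [Bx|Xx]; [left | right; exists X].
    - have [XY|YX] := Ftot _ _ FX FY.
        exists (B `|` Y); split; [exact: FP | by right; apply: XY | by right |].
        by move=> x [Bx|Yx]; [left | right; exists Y].
      exists (B `|` X); split; [exact: FP | by right | by right; apply: YX |].
      by move=> x [Bx|Xx]; [left | right; exists X].
  have [B1 _ _ _ _] := BP; split; first by left.
  - move=> x y c d Sx Sy; have [X [[_ XM _ _ _] Xx Xy XS]] := pick _ _ Sx Sy.
    by apply: XS; exact: XM.
  - move=> x c Sx; have [X [[_ _ XV _ _] Xx _ XS]] := pick _ _ Sx Sx.
    by apply: XS; exact: XV.
  - by move=> x c Sx; have [X [[_ _ _ Xu _] Xx _ XS]] := pick _ _ Sx Sx; exact: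
    Xu Xx.
  - by move=> c Sx; have [X [[_ _ _ _ X1] Xx _ XS]] := pick _ _ Sx Sx; exact:
    X1.
pose T := B `|` M.
have /choice[chi Tchi] x : exists z, T (x, z).
  have [z zu zP] := extension_value x MP.
  have [TP subT Txz] := extension_partial MP zu zP.
  exists z; right; apply: contrapT => Mxz; apply: (M_max (extension T x z)).
    split=> [p Mp|sub]; first by apply: subT; right.
    by apply: Mxz; exact: sub.
  by rewrite /P setUidr // => p Bp; apply: subT; left.
have [T1 TM TV Tu T_inj] := MP.
exists chi; first split=> [x y|x].
- exact: (partial_character_fun MP (Tchi _) (TM _ _ _ _ (Tchi x) (Tchi y))).
- exact: Tu (Tchi x).
by rewrite (partial_character_fun MP (Tchi a) (or_introl Baw)).
Qed.

Lemma character1 chi : character chi -> chi 1%g = 1.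
Proof.
move=> [chiM chiu]; have := chiM 1%g 1%g; rewrite mulg1.
by rewrite -[LHS]mulr1 => /(mulfI (unimodular_neq0 (chiu _))).
Qed.

Lemma finite_roots_of_unity k : (0 < k)%N -> finite_set [set z : C | z ^+ k =
  1].
Proof.
move=> k0; have [r rE] := closed_field_poly_normal ('X^k - 1 : {poly C}).
apply: (@sub_finite_set _ _ [set` r]); last exact: finite_seq.
move=> z /= zk; have : root ('X^k - 1) z by rewrite /root !hornerE zk subrr.
rewrite rE rootZ ?root_prod_XsubC // lead_coef_eq0 -size_poly_eq0.
by rewrite size_XnsubC.
Qed.

(** If there were finitely many characters, the powers of each would repeat, so each would take
    values in a finite group of roots of unity. As characters separate points, [A] would embed in a
    finite product of finite sets. *)
Lemma infinite_characters : infinite_set [set: A] -> infinite_set character.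
Proof.
move=> A_inf ch_fin; apply: A_inf.
have character_pow chi k : character chi -> character (fun x => chi x ^+ k).
  move=> [chiM chiu]; split=> [x y|x]; first by rewrite chiM exprMn.
  by rewrite sqcX chiu expr1n.
have fin_im chi : character chi -> finite_set (range chi).
  move=> chiP; have [_ chiu] := chiP.
  have [k k0 chik] : exists2 k, (0 < k)%N & forall x, chi x ^+ k = 1.
    apply: contrapT => nok; apply: infinite_nat.
    pose f k x := chi x ^+ k.
    have f_inj : {in [set: nat] &, injective f}.
      have W i j : (i <= j)%N -> f i = f j -> i = j.
        move=> ij fij; apply: contrapT => nij; apply: nok.
        exists (j - i)%N => [|x]; first by lia.
        apply: (mulIf (expf_neq0 i (unimodular_neq0 (chiu x)))).
        by rewrite -exprD subnK // mul1r; have := congr1 (@^~ x) fij.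
      move=> i j _ _ fij; have [ij|ij] := leqP i j; first exact: W.
      by apply/esym/W => //; exact: ltnW.
    rewrite -(eq_finite_set (inj_card_eq f_inj)).
    by apply: sub_finite_set ch_fin => _ [k _ <-]; exact: character_pow.
  apply: sub_finite_set (finite_roots_of_unity k0) => _ [x _ <-] /=.
  exact: chik.
have [s sE] : exists s : seq (A -> C), character = [set` s] by
  apply/finite_seqP.
have s_fin : finite_set (range (fun x => [seq chi x | chi <- s])).
  have : forall chi, chi \in s -> character chi by move=> chi; rewrite sE.
  elim: s {sE} => [|chi s IHs] chP.
    by apply: (@sub_finite_set _ _ [set [::]]) => [_ [x _ <-]//|]; exact:
      finite_set1.
  have h1 := fin_im chi (chP _ (mem_head _ _)).
  have h2 := IHs (fun xi xis => chP xi (mem_behead (xis : xi \in behead (chi ::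
    s)))).
  apply: sub_finite_set (finite_image2 cons h1 h2).
  by move=> _ [x _ <-]; exists (chi x); [exists x | exists [seq chi x | chi <-
    s]; [exists x|]].
suff f_inj : {in [set: A] &, injective (fun x => [seq chi x | chi <- s])}.
  by rewrite -(eq_finite_set (inj_card_eq f_inj)).
move=> x y _ _ /eq_in_map xy; apply/eqP; apply: contrapT => /negP nxy.
have /separating_character[chi chiP] : (x * y^-1)%g != 1%g.
  by apply: contra nxy => /eqP h; apply/eqP; rewrite -[x](mulgVK y) h mul1g.
case/eqP; have chi_s : chi \in s by have : character chi by []; rewrite sE.
rewrite chiP.1 (xy _ chi_s) -chiP.1 mulgV; exact: character1.
Qed.

Lemma distinct_characters (I : finType) : infinite_set [set: A] ->
  exists chi : I -> A -> C, (forall i, character (chi i)) /\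
    forall i j, i != j -> exists x, chi i x != chi j x.
Proof.
move=> /infinite_characters/(infinite_set_fset #|I|)[B BP IB].
pose f (i : I) := nth (fun=> 0) (enum_fset B) (enum_rank i).
have lt_i (i : I) : (enum_rank i < size (enum_fset B))%N.
  exact: leq_trans (ltn_ord _) IB.
exists f; split=> [i|i j ij]; first by apply: BP; exact: mem_nth.
apply: contrapT => h; move/eqP: ij; apply.
apply: enum_rank_inj; apply: val_inj; apply/eqP.
rewrite -(nth_uniq (fun=> 0) (lt_i i) (lt_i j) (fset_uniq B)); apply/eqP.
apply/funext => x; apply/eqP; apply: contrapT => /negP xy.
by apply: h; exists x.
Qed.

End Characters.

(** * Free actions with nested orbits *)

(* [l i x y] says that the position of [y] in its F2-orbit, measured from a
   root of that orbit chosen from [x], lies in the i-th ping-pong set. *)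
Record orbit_ping_pong (R : realType) d (X : measurableType d)
    (mu : probability X R) (G : groupType) (beta : G -> X -> X)
    (X0 : set X) (T T' : nat -> X -> X) (l : nat -> X -> X -> bool) : Prop := {
  opp_meas : measurable X0;
  opp_full : mu X0 = 1%E;
  opp_inv : forall g x, X0 x -> X0 (beta g x);
  opp_free : forall x, X0 x -> injective (beta ^~ x);
  opp_TK : forall i x, T i (T' i x) = x;
  opp_T'K : forall i x, T' i (T i x) = x;
  opp_T : forall i x, X0 x -> exists g, T i x = beta g x;
  opp_T' : forall i x, X0 x -> exists g, T' i x = beta g x;
  opp_mT : forall i g, measurable [set x | T i x = beta g x];
  opp_l1 : forall x g i j, X0 x -> l i x (beta g x) -> l j x (beta g x) -> i =
    j;
  opp_l2 : forall x g i j, X0 x -> ~~ l i x (T' i (beta g x)) ->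
    ~~ l j x (T' j (beta g x)) -> i = j;
  opp_l3 : forall x i, X0 x -> ~~ l i x x;
  opp_l4 : forall x i, X0 x -> l i x (T' i x);
  opp_ml : forall i g, measurable (X0 `&` [set x | l i x (beta g x)]) }.

(** Indices are shifted by one so that 0 is free for [i0]. Listing the unit of [G] first will make
    each point the root of its own F2-orbit. *)
Lemma countable_enum (I : Type) (i0 : I) : countable [set: I] ->
  exists e : nat -> I, e 0%N = i0 /\ forall i, exists n, e n = i.
Proof.
move=> /countable_injP[f f_inj].
pose e n := if n is m.+1 then
  if pselect (exists i, f i = m) is left h then sval (cid h) else i0 else i0.
exists e; split=> // i; exists (f i).+1; rewrite /e.
case: pselect => [h|]; last by case; exists i.
by apply: f_inj; rewrite ?inE //; exact: (svalP (cid h)).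
Qed.

Section OrbitPingPong.
Variables (R : realType) (d : measure_display) (X : measurableType d).
Variables (mu : probability X R) (G : groupType).
Variables (alpha : F2 -> X -> X) (beta : G -> X -> X).
Hypothesis X_std : standard_probability mu.
Hypothesis alpha_mp : measure_preserving_action mu alpha.
Hypothesis alpha_free : free_action mu alpha.
Hypothesis beta_mp : measure_preserving_action mu beta.
Hypothesis beta_free : free_action mu beta.
Hypothesis orbits :
  {ae mu, forall x, range (alpha ^~ x) `<=` range (beta ^~ x)}.
Hypothesis G_countable : countable [set: G].

(** This is where standardness enters: [phi] maps [X] injectively and measurably into the line,
    where equality of two measurable functions is a measurable condition. *)
Lemma measurable_coincidence (f g : X -> X) : measurable_fun setT f ->
  measurable_fun setT g -> measurable [set x | f x = g x].
Proof.
move=> mf mg; have [phi [[_ phi_inj _] mphi _ _]] := X_std.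
have h : measurable_fun setT (fun x => phi (f x) == phi (g x)).
  by apply: measurable_fun_eqr; exact: measurableT_comp.
have := h measurableT [set true] I; rewrite setTI.
congr (measurable _); apply/seteqP; split=> x /=.
  by move=> /eqP/phi_inj; apply; rewrite inE.
by move=> ->; exact: eqxx.
Qed.

(** Remove all translates of the exceptional null set by the countable group; almost sure properties
    then hold everywhere on an invariant set. *)
Lemma invariant_conull (P : X -> Prop) : {ae mu, forall x, P x} ->
  exists X0, [/\ measurable X0, mu X0 = 1%E,
    forall g x, X0 x -> X0 (beta g x) & forall x, X0 x -> P x].
Proof.
have [[b1 bM] mb bmu] := beta_mp.
move=> [N [mN N0 PN]]; pose N' := \bigcup_(g in [set: G]) (beta g @^-1` N).
have mpre g : measurable (beta g @^-1` N) by rewrite -[X in measurable X]setTI;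
  exact: mb.
have mN' : measurable N' by apply: countable_bigcupT_measurable.
have N'0 : mu N' = 0%E.
  have [e [_ e_surj]] := countable_enum 1%g G_countable.
  apply/(negligibleP _ mN').
  have -> : N' = \bigcup_k (beta (e k) @^-1` N).
    apply/seteqP; split=> [x [g _ Nx]|x [k _ Nx]]; last by exists (e k).
    by have [k kE] := e_surj g; exists k; rewrite // kE.
  apply: negligible_bigcup => k; apply/(negligibleP _ (mpre _)).
  exact: etrans (bmu _ _ mN) N0.
exists (~` N'); split; first exact: measurableC.
- by rewrite probability_setC // N'0 sube0.
- by move=> g x nN' [h _ Nhx]; apply: nN'; exists (h * g)%g => //=; rewrite bM.
move=> x nN'; apply: contrapT => nP; apply: nN'; exists 1%g => //=.
by rewrite b1; exact: PN.
Qed.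

(** Seen from [x], the root of the F2-orbit of [y] is the first point [beta (e n) x] that lies in
    it, and [s x y] carries this root to [y]. Since [s x] is F2-equivariant on the orbit of [x], the
    relations of the free group carry over; [e 0 = 1] gives [s x x = 1]. *)
Lemma exists_orbit_ping_pong :
  exists X0 T T' l, @orbit_ping_pong R d X mu G beta X0 T T' l.
Proof.
have [[b1 bM] mb bmu] := beta_mp; have [[a1 aM] ma amu] := alpha_mp.
have [X0 [mX0 X01 X0b X0P]] := invariant_conull
  (filterI alpha_free (filterI beta_free orbits)).
have X0af x : X0 x -> injective (alpha ^~ x) by case/X0P.
have X0bf x : X0 x -> injective (beta ^~ x) by case/X0P => _ [].
have X0ab v x : X0 x -> exists g, alpha v x = beta g x.
  by case/X0P => _ [_ /(_ (alpha v x))[|g _ <-]]; [exists v | exists g].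
have [gam [L [L1 L2 L3 L4]]] := F2_ping_pong.
have [e [e0 e_surj]] := countable_enum 1%g G_countable.
pose pos x y n (v : F2) := alpha v (beta (e n) x) = y /\
  forall m, (m < n)%N -> forall v', alpha v' (beta (e m) x) <> y.
(* For [x] in [X0] and [y] in its G-orbit exactly one [v] qualifies, so the default 1 is not taken
   there. *)
pose s x y : F2 := xget 1%g [set v | exists n, pos x y n v].
have pos_uniq x y n n' v v' : X0 x -> pos x y n v -> pos x y n' v' -> v = v'.
  move=> X0x [vy vn] [v'y v'n]; have nn' : n = n'.
    have [nn'|nn'|//] := ltngtP n n'; first by have := v'n _ nn' v.
    by have := vn _ nn' v'.
  by subst n'; apply: (X0af _ (X0b (e n) _ X0x)); rewrite v'y.
have pos_ex x g : X0 x -> exists n v, pos x (beta g x) n v.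
  move=> X0x; have ex : exists n, `[< exists v, alpha v (beta (e n) x) = beta g
    x >].
    by have [n <-] := e_surj g; exists n; apply/asboolP; exists 1%g; rewrite a1.
  have [n /asboolP[v vg] n_min] := ex_minnP ex; exists n, v; split=> // m mn v'
    v'g.
  have /n_min : `[< exists v, alpha v (beta (e m) x) = beta g x >].
    by apply/asboolP; exists v'.
  by rewrite leqNgt mn.
have sP x y n v : X0 x -> pos x y n v -> s x y = v.
  move=> X0x pv; have : [set w | exists m, pos x y m w] (s x y).
    by apply: xgetPex; exists v; exists n.
  by case=> m; move/(pos_uniq _ _ _ _ _ _ X0x)/(_ pv).
have s_equiv x g v : X0 x -> s x (alpha v (beta g x)) = (v * s x (beta g x))%g.
  move=> X0x; have [n [w wP]] := pos_ex x g X0x; rewrite (sP _ _ _ _ X0x wP).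
  apply: (sP _ _ n _ X0x); case: wP => wg wn; split; first by rewrite aM wg.
  move=> m /wn nw v' v'g; apply: (nw (v^-1 * v')%g).
  by rewrite aM v'g -aM mulVg a1.
have s_self x : X0 x -> s x x = 1%g.
  by move=> X0x; apply: (sP _ _ 0%N _ X0x); split; rewrite ?e0 ?b1 ?a1.
have s_meas g v : measurable (X0 `&` [set x | s x (beta g x) = v]).
  have -> : X0 `&` [set x | s x (beta g x) = v] =
      X0 `&` \bigcup_n [set x | pos x (beta g x) n v].
    apply/seteqP; split=> x [X0x]; last by move=> [n _ /(sP _ _ _ _ X0x)].
    move=> /= <-; split=> //; have [n [w wP]] := pos_ex x g X0x.
    by exists n => //=; rewrite (sP _ _ _ _ X0x wP).
  apply: measurableI => //; apply: bigcupT_measurable => n.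
  have mcoin m w : measurable [set x | alpha w (beta (e m) x) = beta g x].
    by apply: measurable_coincidence => //; exact: measurableT_comp.
  have -> : [set x | pos x (beta g x) n v] =
     [set x | alpha v (beta (e n) x) = beta g x] `&`
     \bigcap_(m in `I_n) (~` \bigcup_(w in [set: F2])
       [set x | alpha w (beta (e m) x) = beta g x]).
    apply/seteqP; split=> x [h1 h2]; split=> // m mn.
      by move=> [w _ wg]; exact: (h2 m mn w).
    by move=> w wg; apply: (h2 m mn); exists w.
  apply: measurableI => //; apply: bigcap_measurableType => m _.
  apply: measurableC; apply: countable_bigcupT_measurable => //.
  exact: F2_countable.
exists X0, (fun i => alpha (gam i)), (fun i => alpha (gam i)^-1%g),
  (fun i x y => L i (s x y)); split=> //.
- by move=> i x; rewrite -aM mulgV a1.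
- by move=> i x; rewrite -aM mulVg a1.
- by move=> i x; exact: X0ab.
- by move=> i x; exact: X0ab.
- by move=> i g; apply: measurable_coincidence.
- by move=> x g i j X0x; exact: L1.
- by move=> x g i j X0x; rewrite !s_equiv //; exact: L2.
- by move=> x i X0x; rewrite s_self.
- move=> x i X0x; have := s_equiv x 1%g (gam i)^-1%g X0x.
  by rewrite b1 s_self // mulg1 => ->.
move=> i g.
have -> : X0 `&` [set x | L i (s x (beta g x))] =
    \bigcup_(v in [set: F2]) (if L i v then X0 `&` [set x | s x (beta g x) = v]
      else set0).
  apply/seteqP; split=> [x [X0x Lx]|x [v _]].
    by exists (s x (beta g x)); rewrite // Lx.
  by case: ifPn => // Lv [X0x /= sv]; split=> //=; rewrite sv.
apply: countable_bigcupT_measurable => [|v]; first exact: F2_countable.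
by case: ifP.
Qed.

End OrbitPingPong.

(** * Measurability of complex-valued functions *)

Section ComplexMeasurable.
Variables (R : realType) (d : measure_display) (X : measurableType d).
Variable D : set X.
Implicit Types f g : X -> R[i].

Definition cmeasurable f : Prop :=
  measurable_fun D (fun x => complex.Re (f x)) /\
  measurable_fun D (fun x => complex.Im (f x)).

Lemma cmeasurable_cst (c : R[i]) : cmeasurable (fun=> c).
Proof. by split; exact: measurable_cst. Qed.

Lemma cmeasurableD f g : cmeasurable f -> cmeasurable g ->
  cmeasurable (fun x => f x + g x).
Proof.
move=> [fr fi] [gr gi]; split.
  rewrite (_ : (fun x => _) = (fun x => complex.Re (f x) + complex.Re (g x))).
    exact: measurable_funD.
  by apply/funext => x; case: (f x) (g x) => ? ? [].
rewrite (_ : (fun x => _) = (fun x => complex.Im (f x) + complex.Im (g x))).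
  exact: measurable_funD.
by apply/funext => x; case: (f x) (g x) => ? ? [].
Qed.

Lemma cmeasurableM f g : cmeasurable f -> cmeasurable g ->
  cmeasurable (fun x => f x * g x).
Proof.
move=> [fr fi] [gr gi]; split.
  rewrite (_ : (fun x => _) = (fun x => complex.Re (f x) * complex.Re (g x) -
      complex.Im (f x) * complex.Im (g x))).
    by apply: measurable_funB; exact: measurable_funM.
  by apply/funext => x; case: (f x) (g x) => ? ? [].
rewrite (_ : (fun x => _) = (fun x => complex.Re (f x) * complex.Im (g x) +
    complex.Im (f x) * complex.Re (g x))).
  by apply: measurable_funD; exact: measurable_funM.
by apply/funext => x; case: (f x) (g x) => ? ? [].
Qed.

Lemma cmeasurable_sum I (r : seq I) (F : I -> X -> R[i]) :
  (forall i, cmeasurable (F i)) -> cmeasurable (fun x => \sum_(i <- r) F i x).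
Proof.
move=> mF; elim: r => [|i r IHr].
  rewrite (_ : (fun x => _) = fun=> 0); first exact: cmeasurable_cst.
  by apply/funext => x; rewrite big_nil.
rewrite (_ : (fun x => _) = fun x => F i x + \sum_(j <- r) F j x).
  exact: cmeasurableD.
by apply/funext => x; rewrite big_cons.
Qed.

Lemma cmeasurable_prod I (r : seq I) (F : I -> X -> R[i]) :
  (forall i, cmeasurable (F i)) -> cmeasurable (fun x => \prod_(i <- r) F i x).
Proof.
move=> mF; elim: r => [|i r IHr].
  rewrite (_ : (fun x => _) = fun=> 1); first exact: cmeasurable_cst.
  by apply/funext => x; rewrite big_nil.
rewrite (_ : (fun x => _) = fun x => F i x * \prod_(j <- r) F j x).
  exact: cmeasurableM.
by apply/funext => x; rewrite big_cons.
Qed.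

Lemma cmeasurable_sqc f : cmeasurable f ->
  measurable_fun D (fun x => (sqc (f x))%:E).
Proof.
move=> [fr fi]; apply: measurableT_comp => //.
rewrite /sqc; apply: measurable_funD.
  by apply: (measurable_funX 2).
by apply: (measurable_funX 2).
Qed.

Lemma cmeasurable_nat (E : set X) : measurable D -> measurable (D `&` E) ->
  cmeasurable (fun x => `[< E x >]%:R).
Proof.
move=> mD mE; have m1 : measurable_fun D (\1_(D `&` E) : X -> R).
  by apply: measurable_funTS; exact: measurable_indic.
split; last first.
  rewrite (_ : (fun x => _) = cst 0); first exact: measurable_cst.
  by apply/funext => x; case: asboolP.
apply: eq_measurable_fun m1 => x; rewrite inE => Dx; rewrite indicE.
case: asboolP => Ex; first by rewrite mem_set.
by rewrite memNset // => -[].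
Qed.

Lemma cmeasurable_ext f g : (forall x, D x -> f x = g x) -> cmeasurable f ->
  cmeasurable g.
Proof.
move=> fg [fr fi]; split; [apply: eq_measurable_fun fr | apply:
  eq_measurable_fun fi];
  by move=> x; rewrite inE => /fg ->.
Qed.

Lemma cmeasurable_comp (u : X -> X) f : measurable D -> measurable_fun setT u ->
  (forall x, D x -> D (u x)) -> cmeasurable f -> cmeasurable (fun x => f (u x)).
Proof.
move=> mD mu uD [fr fi]; have mu' : measurable_fun D u by exact:
  measurable_funTS.
have sub : u @` D `<=` D by move=> _ [x Dx <-]; exact: uD.
by split; [apply: (measurable_comp mD sub fr) | apply: (measurable_comp mD sub
  fi)].
Qed.

End ComplexMeasurable.

Lemma cmeasurable_cover (R : realType) d (X : measurableType d) (D : set X)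
    (E : nat -> set X) (f : X -> R[i]) : measurable D ->
  (forall n, measurable (E n)) -> D `<=` \bigcup_n E n ->
  (forall n, cmeasurable (D `&` E n) f) -> cmeasurable D f.
Proof.
move=> mD mE DE mf.
have DE' : D = \bigcup_n (D `&` E n).
  by rewrite -setI_bigcupr; apply/esym/setIidl.
have mDE n : measurable (D `&` E n) by exact: measurableI.
by rewrite DE'; split; apply: (measurable_fun_bigcup _ mDE).2 => n; case: (mf
  n).
Qed.

(** * Square-integrable fields on an orbit equivalence relation *)

Section FiberNorm.
Variables (R : realType) (X : choiceType).
Implicit Types (O : set X) (h : X -> R[i]).
Local Open Scope ereal_scope.

Definition fiber_sqn O h : \bar R := \esum_(p in O) (sqc (h p))%:E.

Lemma fiber_sqn_ge0 O h : 0 <= fiber_sqn O h.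
Proof. by apply: esum_ge0 => p _; rewrite lee_fin sqc_ge0. Qed.

Lemma esumZ O (a : X -> \bar R) (k : R) : (0 <= k)%R -> (forall p, 0 <= a p) ->
  \esum_(p in O) (k%:E * a p) = k%:E * \esum_(p in O) a p.
Proof.
move=> k0 a0; have [->|k_neq0] := eqVneq k 0%R.
  by rewrite mul0e esum1 // => p _; rewrite mul0e.
have le (j : R) (b : X -> \bar R) : (0 < j)%R -> (forall p, 0 <= b p) ->
    \esum_(p in O) (j%:E * b p) <= j%:E * \esum_(p in O) b p.
  move=> j0 b0; apply: ge_ereal_sup => _ [Y [Yfin YO] <-].
  rewrite -ge0_mule_fsumr //; apply: lee_wpmul2l; first by rewrite lee_fin ltW.
  by apply: ereal_sup_ubound; exists Y.
have k_gt0 : (0 < k)%R by rewrite lt_def k_neq0.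
apply/eqP; rewrite eq_le le //=.
rewrite -lee_pdivlMl //.
apply: le_trans (le (k^-1)%R (fun p => k%:E * a p) _ _) => //.
- apply: le_esum => p _; rewrite muleA -EFinM mulVf // mul1e //.
- by rewrite invr_gt0.
by move=> p; rewrite mule_ge0 ?lee_fin.
Qed.

Lemma fiber_sqnZ O c h : fiber_sqn O (fun p => c * h p)%R = (sqc c)%:E *
  fiber_sqn O h.
Proof.
rewrite -esumZ ?sqc_ge0 // => [|p]; last by rewrite lee_fin sqc_ge0.
by apply: eq_esum => p _; rewrite sqcM EFinM.
Qed.

Lemma fiber_sqn_par O h h' :
  fiber_sqn O (fun p => h p + h' p)%R + fiber_sqn O (fun p => h p - h' p)%R =
  2%:E * fiber_sqn O h + 2%:E * fiber_sqn O h'.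
Proof.
have sq0 (z : R[i]) : 0 <= (sqc z)%:E by rewrite lee_fin sqc_ge0.
rewrite -!esumZ // -!esumD //; try by move=> p _; rewrite mule_ge0.
apply: eq_esum => p _; rewrite -!EFinM -!EFinD; congr EFin.
by case: (h p) (h' p) => a b [a' b']; rewrite /sqc /=; ring.
Qed.

End FiberNorm.

(** [os_enum] lists pairs of a level and a group element. By freeness it lists the fiber over each
    point of the domain without repetition, uniformly in the point, which turns sums over fibers
    into series of measurable functions. *)
Record orbit_space (R : realType) := OrbitSpace {
  os_disp : measure_display;
  os_X : measurableType os_disp;
  os_mu : probability os_X R;
  os_G : groupType;
  os_act : os_G -> os_X -> os_X;
  os_dom : set os_X;
  os_enum : nat -> nat * os_G;
  os_mp : measure_preserving_action os_mu os_act;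
  os_mdom : measurable os_dom;
  os_inv : forall g x, os_dom x -> os_dom (os_act g x);
  os_free : forall x, os_dom x -> injective (os_act ^~ x);
  os_enum_bij : bijective os_enum }.

Arguments os_dom {R o} _.

Section FieldSpace.
Variables (R : realType) (Z : orbit_space R).
Notation X := (os_X Z).
Notation mu := (os_mu Z).
Notation G := (os_G Z).
Notation act := (@os_act R Z).
Notation X0 := (@os_dom R Z).
Notation field := (X -> nat * X -> R[i]).
Implicit Types (f g : field) (x : X).

(* Only the values [f x (n, y)] with [y] in the orbit of [x] matter; [n] indexes
   a direct sum of countably many copies of the same space. *)
Definition orbit x : set (nat * X) := [set p | range (act ^~ x) p.2].

Let act1 x : act 1%g x = x.
Proof. by have [[]] := os_mp Z. Qed.

Let actM a b x : act (a * b)%g x = act a (act b x).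
Proof. by have [[]] := os_mp Z. Qed.

Let mact a : measurable_fun setT (act a).
Proof. by have [] := os_mp Z. Qed.

Lemma orbit_act a x : orbit (act a x) = orbit x.
Proof.
apply/seteqP; split=> -[n y] [b _ /= <-].
  by exists (b * a)%g; rewrite //= actM.
by exists (b * a^-1)%g => //=; rewrite -actM mulgVK.
Qed.

Lemma act_domE a x : X0 (act a x) <-> X0 x.
Proof.
split; last exact: os_inv.
by move=> /(os_inv a^-1%g); rewrite -actM mulVg act1.
Qed.

Definition field_sqn f x : \bar R := fiber_sqn (orbit x) (f x).

(** Measurability is asked only along the graphs of the elements of [G]; these cover the orbit
    relation, and values off the orbits are irrelevant. *)
Definition measurable_field f : Prop :=
  forall n a, cmeasurable X0 (fun x => f x (n, act a x)).

Local Open Scope ereal_scope.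

Lemma field_sqn_series f x : X0 x -> field_sqn f x =
  \sum_(k <oo) (sqc (f x ((os_enum Z k).1, act (os_enum Z k).2 x)))%:E.
Proof.
move=> X0x; pose q k : nat * X := ((os_enum Z k).1, act (os_enum Z k).2 x).
have [e' eK e'K] := os_enum_bij Z.
have q_bij : set_bij [set: nat] (orbit x) q.
  split=> [k _|k k' _ _ [h1 /(os_free X0x) h2]|[n y] [a _ /= ay]].
  - by exists (os_enum Z k).2.
  - by apply: (can_inj eK); rewrite (surjective_pairing (os_enum Z k)) h1 h2
    -surjective_pairing.
  by exists (e' (n, a)) => //; rewrite /q e'K /= ay.
rewrite /field_sqn /fiber_sqn (reindex_esum [set: nat] (orbit x) q _ q_bij)
  -nneseries_esumT //.
by move=> k; rewrite lee_fin sqc_ge0.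
Qed.

Lemma measurable_field_sqn f : measurable_field f ->
  measurable_fun X0 (field_sqn f).
Proof.
move=> mf; apply: (@eq_measurable_fun _ _ _ _ _ (fun x =>
  \sum_(k <oo | k \in predT) (sqc (f x ((os_enum Z k).1, act (os_enum Z k).2
    x)))%:E)).
  by move=> x; rewrite inE => /field_sqn_series ->.
apply: ge0_emeasurable_sum => [k x _ _|k _]; first by rewrite lee_fin sqc_ge0.
exact: cmeasurable_sqc.
Qed.

Definition energy f : \bar R := \int[mu]_(x in X0) field_sqn f x.

Lemma energy_ge0 f : 0 <= energy f.
Proof. by apply: integral_ge0 => x _; exact: fiber_sqn_ge0. Qed.

Lemma measurable_fieldZ c f : measurable_field f -> measurable_field (c *: f)%R.
Proof. by move=> mf n a; apply: cmeasurableM => //; exact: cmeasurable_cst. Qed.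

Lemma measurable_fieldD f g : measurable_field f -> measurable_field g ->
  measurable_field (f + g)%R.
Proof. by move=> mf mg n a; exact: cmeasurableD. Qed.

Lemma energyZ c f : measurable_field f -> energy (c *: f)%R = (sqc c)%:E *
  energy f.
Proof.
move=> mf; rewrite -ge0_integralZl ?lee_fin ?sqc_ge0 //.
- by apply: eq_integral => x _; exact: fiber_sqnZ.
- exact: os_mdom.
- exact: measurable_field_sqn.
by move=> x _; exact: fiber_sqn_ge0.
Qed.

Lemma energy_par f g : measurable_field f -> measurable_field g ->
  energy (f + g)%R + energy (f - g)%R = 2%:E * energy f + 2%:E * energy g.
Proof.
move=> mf mg; have m2 h : measurable_field h -> measurable_fun X0 (fun x =>
  2%:E * field_sqn h x).
  by move=> mh; apply: measurable_funeM; exact: measurable_field_sqn.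
have mN : measurable_field (f - g)%R.
  by apply: measurable_fieldD => //; rewrite -scaleN1r; exact:
    measurable_fieldZ.
have F0 h x : 0 <= field_sqn h x by exact: fiber_sqn_ge0.
have F20 h x : 0 <= 2%:E * field_sqn h x by rewrite mule_ge0.
rewrite /energy -!ge0_integralZl //; try exact: os_mdom; try exact:
  measurable_field_sqn.
rewrite -!ge0_integralD //; try exact: os_mdom; try exact: m2;
  try by apply: measurable_field_sqn => //; exact: measurable_fieldD.
by apply: eq_integral => x _; exact: fiber_sqn_par.
Qed.

Definition square_integrable f : Prop := measurable_field f /\ energy f < +oo.

Definition field_pred : {pred field} := [pred f | `[< square_integrable f >]].

Fact field_pred_submod : submod_closed field_pred.
Proof.
split=> [|c f g /asboolP[mf f_fin] /asboolP[mg g_fin]]; apply/asboolP.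
  split; first by move=> n a; exact: cmeasurable_cst.
  have -> : 0%R = (0 *: 0 : field)%R by rewrite scale0r.
  by rewrite energyZ ?sqc0 ?mul0e // => n a; exact: cmeasurable_cst.
have mcf := measurable_fieldZ c mf; split; first exact: measurable_fieldD.
apply: (@le_lt_trans _ _ (2%:E * energy (c *: f)%R + 2%:E * energy g)).
  by rewrite -energy_par // leeDl ?energy_ge0.
by rewrite energyZ // lte_add_pinfty // !lte_mul_pinfty ?lee_fin ?sqc_ge0.
Qed.

HB.instance Definition _ := GRing.isSubmodClosed.Build R[i] field field_pred
  field_pred_submod.

Record field_space := FieldSpace {
  field_val :> field; _ : field_val \in field_pred }.
HB.instance Definition _ := [isSub for field_val].
HB.instance Definition _ := [Choice of field_space by <:].
HB.instance Definition _ := [SubChoice_isSubLmodule of field_space by <:].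

Lemma field_measurable (u : field_space) : measurable_field u.
Proof. by have /asboolP[] := valP u. Qed.

Definition field_space_sqn (u : field_space) : R := fine (energy u).

Lemma energyE (u : field_space) : energy u = (field_space_sqn u)%:E.
Proof.
have /asboolP[_ u_fin] := valP u; rewrite /field_space_sqn fineK //.
by rewrite ge0_fin_numE ?energy_ge0.
Qed.

Fact field_space_sqn_ge0 u : (0 <= field_space_sqn u)%R.
Proof. by rewrite fine_ge0 ?energy_ge0. Qed.

Fact field_space_sqnZ c u : field_space_sqn (c *: u) = (sqc c * field_space_sqn
  u)%R.
Proof.
apply: EFin_inj; rewrite -energyE EFinM -energyE.
exact: energyZ (field_measurable u).
Qed.

Fact field_space_sqn_par u v :
  (field_space_sqn (u + v) + field_space_sqn (u - v) =
   2 * field_space_sqn u + 2 * field_space_sqn v)%R.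
Proof.
apply: EFin_inj; rewrite !EFinD !EFinM -!energyE.
exact: energy_par (field_measurable u) (field_measurable v).
Qed.

Definition fields : preHilbert R := @PreHilbert R field_space field_space_sqn
  field_space_sqn_ge0 field_space_sqnZ field_space_sqn_par.

Lemma fieldsP (u v : fields) : (forall x p, (u : field_space) x p = (v :
  field_space) x p) -> u = v.
Proof. by move=> uv; apply/val_inj/funext => x; apply/funext => p; exact: uv.
  Qed.

Lemma mk_field f (k : R) : measurable_field f -> energy f <= k%:E ->
  exists2 u : fields, (u : field_space) = f :> field & (sqn u <= k)%R.
Proof.
move=> mf fk; have fP : f \in field_pred.
  by apply/asboolP; split=> //; exact: le_lt_trans fk (ltry _).
by exists (FieldSpace fP) => //; rewrite -lee_fin -[sqn _]/(field_space_sqn _)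
  -energyE.
Qed.

Lemma energy_le f g (k : R) : measurable_field f -> measurable_field g -> (0 <=
  k)%R ->
  (forall x, X0 x -> field_sqn f x <= k%:E * field_sqn g x) ->
  energy f <= k%:E * energy g.
Proof.
move=> mf mg k0 fg; rewrite /energy -ge0_integralZl ?lee_fin //.
- apply: ge0_le_integral => //; try exact: os_mdom; try exact:
  measurable_field_sqn.
  + by move=> x _; exact: fiber_sqn_ge0.
  by apply: measurable_funeM; exact: measurable_field_sqn.
- exact: os_mdom.
- exact: measurable_field_sqn.
by move=> x _; exact: fiber_sqn_ge0.
Qed.

(** Since [x] and [act a x] have the same orbit, both fibers are summed over the same set, and
    invariance of the measure gives the change of variables. *)
Lemma energy_shift a f : measurable_field f ->
  energy (fun x => f (act a x)) = energy f.
Proof.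
move=> mf; have [_ _ mpa] := os_mp Z.
rewrite /energy [RHS](_ : _ = \int[pushforward mu (act a)]_(x in X0) field_sqn
  f x).
  rewrite ge0_integral_pushforward //.
  - rewrite (_ : act a @^-1` X0 = X0).
      by apply: eq_integral => x _ /=; rewrite /field_sqn orbit_act.
    by apply/seteqP; split=> x; [exact: (act_domE a x).1 | exact: (act_domE a
      x).2].
  - exact: os_mdom.
  - exact: measurable_field_sqn.
  by move=> x _; exact: fiber_sqn_ge0.
by apply: eq_measure_integral => B mB _; exact/esym/mpa.
Qed.

End FieldSpace.

(** * The wreath product acting on fields *)

Section PingPongBound.
Variables (R : realType) (X : choiceType) (O : set (nat * X)).
Variables (T T' : nat -> X -> X) (l l' : nat -> X -> bool).
Hypothesis OT : forall n i y, O (n, y) -> O (n, T i y).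
Hypothesis TK : forall i y, T' i (T i y) = y.
Hypothesis row : forall n y i j, O (n, y) -> l i y -> l j y -> i = j.
Hypothesis row' : forall n y i j, O (n, y) -> l' i y -> l' j y -> i = j.
Hypothesis col : forall n y i j, O (n, y) ->
  ~~ l i (T' i y) -> ~~ l j (T' j y) -> i = j.
Hypothesis col' : forall n y i j, O (n, y) ->
  ~~ l' i (T' i y) -> ~~ l' j (T' j y) -> i = j.

Lemma sqc_sum_single n (m : nat -> bool) (z : nat -> R[i]) :
  (forall i j, m i -> m j -> i = j) ->
  sqc (\sum_(i < n) (m i)%:R * z i) = \sum_(i < n) (m i)%:R * sqc (z i).
Proof.
move=> m1; have [[i mi]|nm] := pselect (exists i : 'I_n, m i).
  have mj (j : 'I_n) : j != i -> m j = false.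
    by move=> ji; apply: contra_neqF ji => mj; apply/val_inj/m1.
  rewrite (bigD1 i) //= [in RHS](bigD1 i) //= !big1 => [|j ji|j ji].
  - by rewrite mi !mul1r !addr0.
  - by rewrite (mj j ji) mul0r.
  - by rewrite (mj j ji) mul0r.
have mF (i : 'I_n) : m i = false by apply/negP => mi; apply: nm; exists i.
by rewrite !big1 ?sqc0 // => i _; rewrite mF mul0r.
Qed.

(* For fixed [q] in [O] at most one pair [i], [p] with [T i p = q] counts. *)
Lemma column_bound (k : nat -> X -> bool) (h : nat * X -> R[i]) :
  (forall n y i j, O (n, y) -> ~~ k i (T' i y) -> ~~ k j (T' j y) -> i = j) ->
  (\esum_(p in O) (\sum_(i < p.1) (~~ k i p.2)%:R * sqc (h (p.1, T i p.2)))%:E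
    <= fiber_sqn O h)%E.
Proof.
move=> k_col; pose r (p : nat * X) := [seq i <- iota 0 p.1 | ~~ k i p.2].
pose t (q : (nat * X) * nat) : nat * X := (q.1.1, T q.2 q.1.2).
pose K := O `*`` (fun p => [set` r p]).
have -> : (\esum_(p in O) (\sum_(i < p.1) (~~ k i p.2)%:R * sqc (h (p.1, T i
  p.2)))%:E
    = \esum_(q in K) (sqc (h (t q)))%:E)%E.
  rewrite -(@esum_esum _ _ _ O _ (fun p i => (sqc (h (t (p, i))))%:E)); last
    first.
    by move=> p i _ _; rewrite lee_fin sqc_ge0.
  apply: eq_esum => p _; rewrite esum_fset; last 2 first.
  - exact: finite_seq.
  - by move=> i _; rewrite lee_fin sqc_ge0.
  rewrite -fsbig_seq ?filter_uniq ?iota_uniq // big_filter sumEFin.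
  congr EFin; rewrite [RHS]big_mkcond -(big_mkord xpredT
    (fun i => (~~ k i p.2)%:R * sqc (h (p.1, T i p.2)))) /index_iota subn0.
  by apply: eq_bigr => i _; case: (k i p.2); rewrite /= ?mul0r ?mul1r.
have t_inj : set_inj K t.
  move=> [[n y] i] [[n' y'] j]; rewrite !inE /K /r /= => -[/= Oy iy] [/= Oy'
    jy'].
  rewrite /t /= => -[nn' TT]; subst n'.
  move: iy jy'; rewrite !mem_filter => /andP[ki _] /andP[kj _].
  have ij : i = j.
    by apply: (k_col n (T i y)); [exact: OT | rewrite TK | rewrite TT TK].
  by subst j; congr (_, _, _); rewrite -(TK i y) TT TK.
rewrite -(esum_image K t (fun q => (sqc (h q))%:E)) //.
apply: ge_ereal_sup => _ [Y [Yfin YO] <-]; apply: ereal_sup_ubound.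
exists Y => //; split=> // q /YO[[[n y] i] [/= Oy _] <-].
exact: OT.
Qed.

(** Split [l' - l] into its positive part, where [l'] holds and [l] fails, and its negative part. In
    each part disjointness leaves one term per row, and the failing predicate makes [column_bound]
    applicable. Both parts have squared norm at most that of [h], whence the factor 4, uniformly in
    the number of summands. *)
Lemma ping_pong_bound (h : nat * X -> R[i]) :
  (fiber_sqn O (fun p => (\sum_(i < p.1)
     ((l' i p.2)%:R - (l i p.2)%:R) * h (p.1, T i p.2))%R)
   <= 4%:E * fiber_sqn O h)%E.
Proof.
pose S (k : nat -> X -> bool) (p : nat * X) : R := \sum_(i < p.1) (~~ k i
  p.2)%:R * sqc (h (p.1, T i p.2)).
have S0 k p : 0 <= S k p.
  by apply: sumr_ge0 => i _; rewrite mulr_ge0 ?sqc_ge0 ?ler0n.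
have pointwise p : O p -> sqc (\sum_(i < p.1)
    ((l' i p.2)%:R - (l i p.2)%:R) * h (p.1, T i p.2)) <= 2 * (S l p + S l' p).
  case: p => n y Oy; rewrite /S /=; set z := fun i => h (n, T i y).
  have -> : \sum_(i < n) ((l' i y)%:R - (l i y)%:R) * z i =
      \sum_(i < n) (l' i y && ~~ l i y)%:R * z i +
      - \sum_(i < n) (l i y && ~~ l' i y)%:R * z i :> R[i].
    rewrite -sumrB; apply: eq_bigr => i _.
    by case: (l' i y) (l i y) => [] [] /=; rewrite ?subrr ?subr0 ?sub0r; ring.
  have s1 := @sqc_sum_single n (fun i => l' i y && ~~ l i y) z.
  have s2 := @sqc_sum_single n (fun i => l i y && ~~ l' i y) z.
  apply: (le_trans (sqcD_le2 _ _)); rewrite sqcN ler_pM2l // s1 ?s2.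
  - by rewrite lerD // ler_sum // => i _;
      rewrite ler_wpM2r ?sqc_ge0 // ler_nat; case: (l i y) (l' i y) => [] [].
  - by move=> i j /andP[li _] /andP[lj _]; exact: row Oy li lj.
  by move=> i j /andP[li _] /andP[lj _]; exact: row' Oy li lj.
apply: (@le_trans _ _ (\esum_(p in O) (2%:E * ((S l p)%:E + (S l' p)%:E)))%E).
  by apply: le_esum => p Op; rewrite -EFinD -EFinM lee_fin pointwise.
rewrite esumZ // => [|p]; last by rewrite adde_ge0 ?lee_fin.
rewrite esumD; try by move=> p _; rewrite lee_fin.
have -> : (4%:E * fiber_sqn O h = 2%:E * (fiber_sqn O h + fiber_sqn O h))%E.
  by rewrite -mule2n -[(_ *+ 2)%E]mule_natl muleA -EFinM -natrM.
apply: lee_wpmul2l => //; apply: leeD; [exact: column_bound col | exact: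
  column_bound col'].
Qed.

End PingPongBound.

(** * Characters of the lamp group *)

Section LampCharacters.
Variables (R : realType) (A G : groupType) (X : Type) (act : G -> X -> X).
Hypothesis act1 : forall x, act 1%g x = x.
Hypothesis actM : forall a b x, act (a * b)%g x = act a (act b x).
Variable th : X -> A -> R[i].
Hypothesis th_char : forall x, character (th x).
Local Open Scope fset_scope.
Implicit Types (a b : lamps A G) (x : X).

Definition lamp_char a x : R[i] := \prod_(s <- finsupp a) th (act s^-1%g x) (a
  s).

Lemma lamp_char_big a (S : {fset G}) x : finsupp a `<=` S ->
  lamp_char a x = \prod_(s <- S) th (act s^-1%g x) (a s).
Proof.
move=> aS; apply: (big_fset_incl _ aS) => s _ sa.
by rewrite fsfun_dflt // (character1 (th_char _)).
Qed.

Lemma lamp_charM a b x : lamp_char (lamps_mul a b) x = lamp_char a x *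
  lamp_char b x.
Proof.
pose S := finsupp a `|` finsupp b.
rewrite (@lamp_char_big _ S) ?(@lamp_char_big a S) ?(@lamp_char_big b S).
- rewrite -big_split; apply: eq_bigr => s _.
  by rewrite lamps_mulE; have [-> _] := th_char (act s^-1%g x).
- exact: fsubsetUr.
- exact: fsubsetUl.
apply/fsubsetP => s; rewrite mem_finsupp lamps_mulE; apply: contraNT.
rewrite !inE negb_or => /andP[sa sb].
by rewrite (fsfun_dflt sa) (fsfun_dflt sb) mulg1.
Qed.

Lemma lamp_char_act g a x : lamp_char (lamps_act g a) x = lamp_char a (act
  g^-1%g x).
Proof.
rewrite (@lamp_char_big _ [fset (g * s)%g | s in finsupp a]).
  rewrite big_imfset /=; last by move=> s s' _ _ /mulgI.
  apply: eq_bigr => s _; rewrite lamps_actE mulKg invgM actM //.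
apply/fsubsetP => t; rewrite mem_finsupp lamps_actE => agt.
by apply/imfsetP; exists (g^-1 * t)%g; rewrite ?mulVKg //= mem_finsupp.
Qed.

Lemma sqc_lamp_char a x : sqc (lamp_char a x) = 1.
Proof.
rewrite /lamp_char; elim/big_rec: _ => [|s z _ IH]; first exact: sqc1.
by rewrite sqcM IH mulr1; have [_ ->] := th_char (act s^-1%g x).
Qed.

Lemma lamp_char1 x : lamp_char (wreath_base (1%g : wreath A G)) x = 1.
Proof.
rewrite (@lamp_char_big _ fset0) ?big_seq_fset0 //.
by apply/fsubsetP => s; rewrite mem_finsupp fsfun0E eqxx.
Qed.

End LampCharacters.

Section WreathOperators.
Variables (R : realType) (Z : orbit_space R) (A : groupType).
Notation X := (os_X Z).
Notation G := (os_G Z).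
Notation act := (@os_act R Z).
Notation X0 := (@os_dom R Z).
Notation field := (X -> nat * X -> R[i]).
Notation W := (wreath A G).
Variables (T T' : nat -> X -> X) (l : nat -> X -> X -> bool).
Hypothesis opp : orbit_ping_pong (os_mu Z) act X0 T T' l.
Variable th : nat -> X -> A -> R[i].
Hypothesis th_char : forall n x, character (th n x).
Hypothesis th_meas : forall n a, cmeasurable X0 (fun x => th n x a).
Implicit Types (f : field) (x : X) (w : W) (u v : fields Z).

Let act1 x : act 1%g x = x.
Proof. by have [[]] := os_mp Z. Qed.

Let actM a b x : act (a * b)%g x = act a (act b x).
Proof. by have [[]] := os_mp Z. Qed.

Let mact a : measurable_fun setT (act a).
Proof. by have [] := os_mp Z. Qed.

Let actVK a x : act a (act a^-1%g x) = x.
Proof. by rewrite -actM mulgV act1. Qed.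

Notation ch w n x := (lamp_char act (th n) (wreath_base w) x).
Notation top w := (wreath_top w).

Definition translate w f : field :=
  fun x p => ch w p.1 x * f (act (top w)^-1%g x) p.

(* [P (translate w) - (translate w) P], for the operator
   [P f x (n, y) = \sum_(i < n) (~~ l i x y)%:R * f x (n, T i y)], which is
   bounded on each level [n] but not uniformly in [n]. *)
Definition derivation w f : field := fun x p => ch w p.1 x *
  \sum_(i < p.1) ((l i (act (top w)^-1%g x) p.2)%:R - (l i x p.2)%:R) *
    f (act (top w)^-1%g x) (p.1, T i p.2).

(** The cocycle identity that makes [translate] multiplicative and gives [derivation] its Leibniz
    rule. *)
Lemma chM w w' n x : ch (w * w')%g n x = ch w n x * ch w' n (act (top w)^-1%g
  x).
Proof. by rewrite -(lamp_char_act actM) // -lamp_charM. Qed.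

Lemma sqc_ch w n x : sqc (ch w n x) = 1.
Proof. exact: sqc_lamp_char. Qed.

Lemma measurable_shift a (h : X -> R[i]) : cmeasurable X0 h ->
  cmeasurable X0 (fun x => h (act a x)).
Proof.
apply: cmeasurable_comp => //; first exact: os_mdom.
by move=> x; exact: os_inv.
Qed.

Lemma measurable_ch w n : cmeasurable X0 (fun x => ch w n x).
Proof.
apply: cmeasurable_prod => s; exact: (@measurable_shift s^-1%g (fun x => th n x
  _)).
Qed.

Lemma measurable_translate w f : measurable_field f ->
  measurable_field (translate w f).
Proof.
move=> mf n a; apply: cmeasurableM; first exact: measurable_ch.
have := @measurable_shift (top w)^-1%g _ (mf n (a * top w)%g).
by apply: cmeasurable_ext => x _; rewrite actM actVK.
Qed.

(** The domain is covered by countably many measurable pieces [E m], on each of which [T i] after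
    [act a] coincides with a single element of [G]. *)
Lemma measurable_generator f n i a : measurable_field f ->
  cmeasurable X0 (fun x => f x (n, T i (act a x))).
Proof.
move=> mf; pose E m : set X := [set x | T i (act a x) = act (os_enum Z m).2 x].
apply: (@cmeasurable_cover _ _ _ _ E); first exact: os_mdom.
- move=> m; rewrite /E; set g := (os_enum Z m).2.
  have mTi := opp_mT opp i (g * a^-1)%g.
  have := mact a measurableT mTi; rewrite setTI; congr (measurable _).
  by apply/seteqP; split=> x /=; rewrite actM -(actM a^-1%g) mulVg act1.
- move=> x X0x; have [g Tg] := opp_T opp i (os_inv a X0x).
  have [e' eK e'K] := os_enum_bij Z.
  by exists (e' (n, (g * a)%g)); rewrite /E //= e'K Tg actM.
move=> m; apply: (@cmeasurable_ext _ _ _ _ (fun x => f x (n, act (os_enum Z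
  m).2 x))).
  by move=> x [_ Ex]; rewrite -Ex.
have [mr mi] := mf n (os_enum Z m).2.
have mX0 := os_mdom Z.
by split; [apply: measurable_funS mr | apply: measurable_funS mi].
Qed.

Lemma measurable_pos i a : cmeasurable X0 (fun x => (l i x (act a x))%:R :
  R[i]).
Proof.
have := @cmeasurable_nat R _ X X0 [set x | l i x (act a x)] (os_mdom Z) (opp_ml
  opp i a).
by apply: cmeasurable_ext => x _; congr (_%:R); rewrite /= asboolb.
Qed.

Lemma measurable_derivation w f : measurable_field f ->
  measurable_field (derivation w f).
Proof.
move=> mf n a; apply: cmeasurableM; first exact: measurable_ch.
apply: (@cmeasurable_sum _ _ _ _ _ (index_enum 'I_n) (fun i x =>
  ((l i (act (top w)^-1%g x) (act a x))%:R - (l i x (act a x))%:R) *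
  f (act (top w)^-1%g x) (n, T i (act a x)))) => i.
apply: cmeasurableM; last first.
  have := @measurable_shift (top w)^-1%g _ (@measurable_generator f n i (a *
    top w)%g mf).
  by apply: cmeasurable_ext => x _; rewrite actM actVK.
apply: cmeasurableD.
  have := @measurable_shift (top w)^-1%g _ (@measurable_pos i (a * top w)%g).
  by apply: cmeasurable_ext => x _; rewrite actM actVK.
have := cmeasurableM (cmeasurable_cst X0 (-1)) (@measurable_pos i a).
by apply: cmeasurable_ext => x _; rewrite mulN1r.
Qed.

Lemma fiber_sqn_unit (O : set (nat * X)) (c h : nat * X -> R[i]) :
  (forall p, sqc (c p) = 1) -> fiber_sqn O (fun p => c p * h p) = fiber_sqn O h.
Proof. by move=> c1; apply: eq_esum => p _; rewrite sqcM c1 mul1r. Qed.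

Lemma energy_translate w f : measurable_field f ->
  energy (translate w f) = energy f.
Proof.
move=> mf; rewrite -(energy_shift (top w)^-1%g mf); apply: eq_integral => x _.
by apply: (@fiber_sqn_unit _ (fun p => ch w p.1 x)) => p; exact: sqc_ch.
Qed.

(** Up to a unimodular factor, the derivation over [x] is the operator of [ping_pong_bound] for the
    two families of positions measured from [x] and from [x'], which share one orbit. *)
Lemma energy_derivation w f : measurable_field f ->
  (energy (derivation w f) <= 4%:E * energy f)%E.
Proof.
move=> mf; rewrite -(energy_shift (top w)^-1%g mf); apply: energy_le => //.
- exact: measurable_derivation.
- move=> n a; have := @measurable_shift (top w)^-1%g _ (mf n (a * top w)%g).
  by apply: cmeasurable_ext => x _; rewrite actM actVK.
move=> x X0x; set x' := act (top w)^-1%g x.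
have X0x' : X0 x' by exact: os_inv.
rewrite /field_sqn /derivation
  (@fiber_sqn_unit _ (fun p => ch w p.1 x)); last by move=> p; exact: sqc_ch.
have orb y : range (act^~ x) y -> range (act^~ x') y.
  by move=> [a _ <-]; exists (a * top w)%g; rewrite // actM /x' actVK.
apply: (@ping_pong_bound _ _ _ T T' (fun i y => l i x y) (fun i y => l i x' y)).
- move=> n i y [a _ /= <-]; have [g Tg] := opp_T opp i (os_inv a X0x).
  by exists (g * a)%g; rewrite //= Tg actM.
- exact: opp_T'K opp.
- by move=> n y i j [a _ /= <-]; exact: opp_l1 opp _ _ _ _ X0x.
- by move=> n y i j /orb[a _ /= <-]; exact: opp_l1 opp _ _ _ _ X0x'.
- by move=> n y i j [a _ /= <-]; exact: opp_l2 opp _ _ _ _ X0x.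
by move=> n y i j /orb[a _ /= <-]; exact: opp_l2 opp _ _ _ _ X0x'.
Qed.

Lemma exists_operators : exists L D : W -> fields Z -> fields Z,
  [/\ forall w u, (L w u : field_space Z) = translate w (u : field_space Z) :>
    field,
      forall w u, (D w u : field_space Z) = derivation w (u : field_space Z) :>
        field,
      forall w u, sqn (L w u) = sqn u &
      forall w u, sqn (D w u) <= 4 * sqn u].
Proof.
have /choice[L LP] (q : W * fields Z) : exists v : fields Z,
    (v : field_space Z) = translate q.1 (q.2 : field_space Z) :> field /\
    sqn v = sqn q.2.
  case: q => w u; have mu := field_measurable u.
  have [||v vE _] := @mk_field _ _ (translate w (u : field_space Z)) (sqn u).
  - exact: measurable_translate.
  - by rewrite energy_translate // energyE.
  exists v; split=> //; apply: EFin_inj.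
  rewrite -[sqn v]/(field_space_sqn _) -[sqn _]/(field_space_sqn u) -!energyE
    vE.
  exact: energy_translate.
have /choice[D DP] (q : W * fields Z) : exists v : fields Z,
    (v : field_space Z) = derivation q.1 (q.2 : field_space Z) :> field /\
    sqn v <= 4 * sqn q.2.
  case: q => w u; have mu := field_measurable u.
  have [||v vE v_le] := @mk_field _ _ (derivation w (u : field_space Z)) (4 *
    sqn u).
  - exact: measurable_derivation.
  - by rewrite EFinM -[sqn u]/(field_space_sqn u) -energyE; exact:
    energy_derivation.
  by exists v.
exists (fun w u => L (w, u)), (fun w u => D (w, u)).
by split=> w u; [have [] := LP (w, u) | have [] := DP (w, u)
  | have [] := LP (w, u) | have [] := DP (w, u)].
Qed.

(** The last clause admits any fields with the prescribed values instead of naming the operators, so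
    that it applies directly to explicit indicator fields. *)
Lemma unitarizable_wreath_form : unitarizable R W ->
  exists (B : fields Z -> fields Z -> R[i]) (C : R),
  [/\ forall c u u' v, B (c *: u + u') v = c * B u v + B u' v,
      forall c u v v', B u (c *: v + v') = c^*%C * B u v + B u v',
      forall u v, sqc (B u v) <= C * (sqn u * sqn v) &
      forall w u v (Lu Lv DLu : fields Z),
        (Lu : field_space Z) = translate w (u : field_space Z) :> field ->
        (Lv : field_space Z) = translate w (v : field_space Z) :> field ->
        (DLu : field_space Z) = derivation w^-1%g (Lu : field_space Z) :> field
          ->
        B u v = B Lu Lv + polar DLu v].
Proof.
have [L [D [LE DE L_isom D_le]]] := exists_operators.
have valD c u v x p : (c *: u + v : field_space Z) x p =
  c * (u : field_space Z) x p + (v : field_space Z) x p by [].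
have L_lin w c u v : L w (c *: u + v) = c *: L w u + L w v.
  by apply: fieldsP => x p; rewrite valD !LE /translate valD; ring.
have D_lin w c u v : D w (c *: u + v) = c *: D w u + D w v.
  apply: fieldsP => x p; rewrite valD !DE /derivation.
  rewrite mulrCA -mulrDr; congr (_ * _); rewrite mulr_sumr -big_split.
  by apply: eq_bigr => i _; rewrite valD /=; ring.
have L1 u : L 1%g u = u.
  apply: fieldsP => x p; rewrite LE /translate invg1 act1.
  by rewrite (lamp_char1 act (th_char p.1)) mul1r.
have LM w w' u : L (w * w')%g u = L w (L w' u).
  apply: fieldsP => x p; rewrite !LE /translate chM.
  by rewrite /= invgM actM mulrA.
have DM w w' u : D (w * w')%g u = L w (D w' u) + D w (L w' u).
  apply: fieldsP => x p; rewrite -[RHS]/((L w (D w' u) : field_space Z) x p +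
    (D w (L w' u) : field_space Z) x p).
  rewrite !(LE, DE) /translate /derivation chM.
  rewrite /= invgM actM -!mulrA -mulrDr; congr (_ * _).
  set c := ch w' p.1 _; set x' := act (top w)^-1%g x.
  rewrite !mulr_sumr -big_split; apply: eq_bigr => i _ /=; ring.
move=> /(unitarizable_triangular L_lin L1 LM L_isom D_lin DM D_le).
move=> [B [C [B1 B2 B3 B4]]]; exists B, C; split=> // w u v Lu Lv DLu LuE LvE
  DLuE.
have -> : Lu = L w u by apply: fieldsP => x p; rewrite LuE LE.
have -> : Lv = L w v by apply: fieldsP => x p; rewrite LvE LE.
have -> : DLu = D w^-1%g (L w u).
  by apply: fieldsP => x p; rewrite DLuE LuE DE LE.
exact: B4.
Qed.

End WreathOperators.

(** * The derivation is not inner *)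

Section Indicators.
Variables (R : realType) (Z : orbit_space R).
Notation X := (os_X Z).
Notation mu := (os_mu Z).
Notation G := (os_G Z).
Notation act := (@os_act R Z).
Notation X0 := (@os_dom R Z).
Notation field := (X -> nat * X -> R[i]).
Implicit Types (E F : set X) (a b : G) (u v : fields Z).

Let act1 x : act 1%g x = x.
Proof. by have [[]] := os_mp Z. Qed.

Let actM a b x : act (a * b)%g x = act a (act b x).
Proof. by have [[]] := os_mp Z. Qed.

Definition indicator n E a : field :=
  fun x p => (`[< E x /\ p = (n, act a x) >])%:R.

Lemma measurable_indicator n E a : measurable E -> E `<=` X0 ->
  measurable_field (indicator n E a).
Proof.
move=> mE EX n' b; have mX0 := os_mdom Z.
have [[nn ab]|nab] := pselect (n' = n /\ b = a).
  have := @cmeasurable_nat R _ X X0 E mX0 (measurableI _ _ mX0 mE).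
  apply: cmeasurable_ext => x X0x; congr (_%:R); rewrite nn ab.
  by congr (nat_of_bool _); apply: asbool_equiv_eq; split=> [|[]].
apply: cmeasurable_ext (cmeasurable_cst X0 0) => x X0x.
rewrite /indicator asboolF // => -[_ [nn ab]]; apply: nab; split=> //.
exact: os_free X0x _ _ ab.
Qed.

Lemma energy_indicator n E a : measurable E -> E `<=` X0 ->
  energy (indicator n E a) = mu E.
Proof.
move=> mE EX; rewrite -[in RHS](setIidl EX) -integral_indic //; last exact:
  os_mdom.
apply: eq_integral => x; rewrite inE => X0x; rewrite indicE /field_sqn
  /fiber_sqn.
rewrite /indicator.
have [Ex|nEx] := pselect (E x); last first.
  rewrite memNset // esum1 // => p _.
  by rewrite asboolF ?sqc0 // => -[].
rewrite mem_set // (eq_esum (b := fun p => if p \in [set (n, act a x)] then 1%E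
  else 0%E)).
  rewrite -(esum_mkcondr _ _ (fun=> 1%E)) (_ : _ `&` _ = [set (n, act a x)]).
    by rewrite esum_set1.
  by apply/setIidr => _ -> ; exists a.
move=> p _; case: asboolP => [[_ ->]|np]; first by rewrite mem_set //= sqc1.
by rewrite memNset ?sqc0 // => /= pE; apply: np.
Qed.

Lemma exists_indicator n E a : measurable E -> E `<=` X0 ->
  exists2 u : fields Z, (u : field_space Z) = indicator n E a :> field &
    sqn u = fine (mu E).
Proof.
move=> mE EX; have muE : mu E = (fine (mu E))%:E by rewrite fineK //
  fin_num_measure.
have [||u uE _] := @mk_field _ Z (indicator n E a) (fine (mu E)).
- exact: measurable_indicator.
- by rewrite energy_indicator // -muE.
by exists u => //; rewrite -[LHS]/(fine (energy _)) uE energy_indicator.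
Qed.

Lemma polar_disjoint u v : (forall x p, X0 x ->
    (u : field_space Z) x p = 0 \/ (v : field_space Z) x p = 0) -> polar u v =
      0.
Proof.
have rp0 (u' v' : fields Z) : (forall x p, X0 x ->
    (u' : field_space Z) x p = 0 \/ (v' : field_space Z) x p = 0) -> repolar u'
      v' = 0.
  move=> uv; rewrite /repolar (_ : sqn (u' + v') = sqn (u' - v')) ?subrr ?mul0r
    //.
  congr fine; apply: eq_integral => x; rewrite inE => X0x; apply: eq_esum => p
    _.
  congr EFin; rewrite -[X in sqc X]/((u' : field_space Z) x p + (v' :
    field_space Z) x p).
  rewrite -[X in _ = sqc X]/((u' : field_space Z) x p - (v' : field_space Z) x
    p).
  by have [->|->] := uv x p X0x; rewrite ?add0r ?sub0r ?sqcN ?addr0 ?subr0.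
move=> uv; rewrite polar.unlock !rp0 // => x p X0x.
have [->|v0] := uv x p X0x; [by left | right].
by rewrite -[LHS]/('i%C * (v : field_space Z) x p) v0 mulr0.
Qed.

End Indicators.

Section NotUnitarizable.
Variables (R : realType) (Z : orbit_space R).
Notation X := (os_X Z).
Notation mu := (os_mu Z).
Notation G := (os_G Z).
Notation act := (@os_act R Z).
Notation X0 := (@os_dom R Z).
Notation field := (X -> nat * X -> R[i]).
Variables (T T' : nat -> X -> X) (l : nat -> X -> X -> bool).
Hypothesis opp : orbit_ping_pong mu act X0 T T' l.
Variable A : groupType.
Notation W := (wreath A G).

Let act1 x : act 1%g x = x.
Proof. by have [[]] := os_mp Z. Qed.

Let actM a b x : act (a * b)%g x = act a (act b x).
Proof. by have [[]] := os_mp Z. Qed.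

Let actVK a x : act a (act a^-1%g x) = x.
Proof. by rewrite -actM mulgV act1. Qed.

Let actKV a x : act a^-1%g (act a x) = x.
Proof. by rewrite -actM mulVg act1. Qed.

Let mX0 : measurable X0. Proof. exact: os_mdom. Qed.

Notation e_ k := (os_enum Z k).2.

(** At the common image both [T' i] and [T' j] lead back to [x], which lies in none of its own
    ping-pong sets; disjointness of the sets [g_i (F2 \ L_i)] gives [i = j]. *)
Lemma T_index_inj x i j : X0 x -> T i x = T j x -> i = j.
Proof.
move=> X0x Tij; have [a Ta] := opp_T opp i X0x.
apply: (opp_l2 opp (g := a) X0x); rewrite -Ta.
  by rewrite (opp_T'K opp); exact: opp_l3 opp _ _ X0x.
by rewrite Tij (opp_T'K opp); exact: opp_l3 opp _ _ X0x.
Qed.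

Definition reached i K : set X :=
  X0 `&` [set x | exists2 k, (k < K)%N & T i x = act (e_ k) x].

Lemma measurable_reached i K : measurable (reached i K).
Proof.
have -> : reached i K =
    X0 `&` \bigcup_(k in [set k | (k < K)%N]) [set x | T i x = act (e_ k) x].
  by congr (_ `&` _); apply/seteqP; split=> x [k kK Tk]; exists k.
by apply: measurableI => //; apply: bigcup_measurable => k _; exact: opp_mT opp
  _ _.
Qed.

(** The sets [reached i K] increase with [K] to [X0], of measure 1; any constant below 1 could
    replace one half. *)
Lemma reached_half i : exists K, 2^-1 <= fine (mu (reached i K)).
Proof.
apply: contrapT => noK.
have small K : (mu (reached i K) <= (2^-1)%:E)%E.
  have muK : mu (reached i K) = (fine (mu (reached i K)))%:E.
    by rewrite fineK // fin_num_measure //; exact: measurable_reached.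
  rewrite muK lee_fin leNgt; apply/negP => /ltW ?; by apply: noK; exists K.
have cover : \bigcup_K reached i K = X0.
  apply/seteqP; split=> [x [K _ []] //|x X0x].
  have [a Ta] := opp_T opp i X0x; have [e' _ e'K] := os_enum_bij Z.
  exists (e' (0%N, a)).+1 => //; split=> //.
  by exists (e' (0%N, a)); rewrite // e'K.
have := @nondecreasing_cvg_mu _ _ _ mu (reached i) (measurable_reached i).
rewrite cover => /(_ mX0) cv.
have {}cv : (mu \o reached i) K @[K --> \oo] --> mu X0.
  apply: cv => K K' KK'; rewrite subsetEset => x [X0x [k kK Tk]].
  by split=> //; exists k => //; exact: leq_trans kK KK'.
have : (mu X0 <= (2^-1)%:E)%E.
  rewrite -(cvg_lim _ cv) //; apply: lime_le; first by apply/cvg_ex; exists (mu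
    X0).
  by apply: nearW => K; exact: small.
by rewrite (opp_full opp) lee_fin; lra.
Qed.

Section Level.
Variables (n K : nat).
Hypothesis K_half : forall i : 'I_n, 2^-1 <= fine (mu (reached i K)).
Notation cell := {ffun 'I_n * 'I_K -> bool}.
Implicit Types (c : cell) (i : 'I_n).

(** The label records which of the first [K] listed group elements agree with each [T i] at [x]. Its
    level sets are the cells that the characters of [A] will separate. *)
Definition label (x : X) : cell := [ffun q : 'I_n * 'I_K => T q.1 x == act (e_
  q.2) x].

Definition hit c i := [exists k, c (i, k)].

(** Several [k] may qualify, as the list repeats each element of [G]; they all agree with [T i] on
    the cell. The default 1 occurs only when [hit c i] fails, and such pairs are left out of the
    sums. *)
Definition jump c i : G := if [pick k | c (i, k)] is Some k then e_ k else 1%g.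

Definition cell_set c : set X := X0 `&` [set x | label x = c].

Lemma measurable_cell_set c : measurable (cell_set c).
Proof.
have -> : cell_set c = X0 `&` \bigcap_(q in [set: 'I_n * 'I_K])
    (if c q then [set x | T q.1 x = act (e_ q.2) x]
            else ~` [set x | T q.1 x = act (e_ q.2) x]).
  congr (_ `&` _); apply/seteqP; split=> [x /= <- q _|x cx].
    by rewrite ffunE; case: eqP.
  apply/ffunP => q; rewrite ffunE; have := cx q I.
  by case: (c q) => /= [/eqP -> // | /eqP/negPf].
apply: measurableI => //; apply: fin_bigcap_measurable => // q _.
have mq := opp_mT opp q.1 (e_ q.2).
by case: (c q) => //; exact: measurableC.
Qed.

Lemma jumpP c i x : cell_set c x -> hit c i -> T i x = act (jump c i) x.
Proof.
move=> [_ <-] /existsP[k0 ck0]; rewrite /jump.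
case: pickP => [k|/(_ k0)]; last by rewrite ck0.
by rewrite ffunE => /eqP.
Qed.

Lemma reachedE i : reached i K = [set x | X0 x /\ hit (label x) i].
Proof.
apply/seteqP; split=> x [X0x].
  move=> [k kK Tk]; split=> //; apply/existsP; exists (Ordinal kK).
  by rewrite ffunE /= Tk.
by move=> /existsP[k]; rewrite ffunE => /eqP Tk; split=> //; exists k.
Qed.

End Level.

Variable Kf : nat -> nat.
Hypothesis Kf_half : forall n (i : 'I_n), 2^-1 <= fine (mu (reached i (Kf n))).
Notation cell n := {ffun 'I_n * 'I_(Kf n) -> bool}.
Variable th : forall n, cell n -> A -> R[i].
Hypothesis th_char : forall n c, character (@th n c).
Hypothesis th_sep : forall n (c c' : cell n), c != c' -> exists a, th c a != th
  c' a.
Notation lab n := (@label n (Kf n)).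
Notation thX := (fun n x => @th n (lab n x)).

Lemma measurable_cell_character n a : cmeasurable X0 (fun x => thX n x a).
Proof.
have := @cmeasurable_sum R _ X X0 _ (index_enum (cell n))
  (fun c x => (`[< cell_set c x >])%:R * th c a).
have mc c : cmeasurable X0 (fun x => (`[< @cell_set n (Kf n) c x >])%:R * th c
  a).
  apply: cmeasurableM; last exact: cmeasurable_cst.
  apply: cmeasurable_nat => //; apply: measurableI => //.
  exact: measurable_cell_set.
move=> /(_ mc); apply: cmeasurable_ext => x X0x.
rewrite (bigD1 (lab n x)) //= big1 => [|c cx].
  by rewrite asboolT ?mul1r ?addr0.
rewrite asboolF ?mul0r // => -[_ /= lx].
by rewrite lx eqxx in cx.
Qed.

Variables (B : fields Z -> fields Z -> R[i]) (C : R).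
Hypothesis B_linl : forall c u u' v, B (c *: u + u') v = c * B u v + B u' v.
Hypothesis B_linr : forall c u v v', B u (c *: v + v') = c^*%C * B u v + B u v'.
Hypothesis B_le : forall u v, sqc (B u v) <= C * (sqn u * sqn v).
Hypothesis B_form : forall (w : W) u v (Lu Lv DLu : fields Z),
  (Lu : field_space Z) = translate thX w (u : field_space Z) :> field ->
  (Lv : field_space Z) = translate thX w (v : field_space Z) :> field ->
  (DLu : field_space Z) = derivation T l thX w^-1%g (Lu : field_space Z) :>
    field ->
  B u v = B Lu Lv + polar DLu v.

Let B0l v : B 0 v = 0.
Proof.
by have := B_linl (-1) 0 0 v; rewrite scaler0 addr0 mulN1r addNr.
Qed.

Let B0r u : B u 0 = 0.
Proof.
have := B_linr (-1) u 0 0; rewrite scaler0 addr0 rmorphN1 mulN1r addNr.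
by [].
Qed.

Let BZl c u v : B (c *: u) v = c * B u v.
Proof. by have := B_linl c u 0 v; rewrite addr0 B0l addr0. Qed.

Let BZr c u v : B u (c *: v) = c^*%C * B u v.
Proof. by have := B_linr c u v 0; rewrite addr0 B0r addr0. Qed.

Let B_suml I (r : seq I) (Q : pred I) (F : I -> fields Z) v :
  B (\sum_(i <- r | Q i) F i) v = \sum_(i <- r | Q i) B (F i) v.
Proof.
elim/big_rec2: _ => [|i x y _ <-]; first exact: B0l.
by rewrite -[F i in LHS]scale1r B_linl mul1r.
Qed.

Let B_sumr I (r : seq I) (Q : pred I) (F : I -> fields Z) u :
  B u (\sum_(i <- r | Q i) F i) = \sum_(i <- r | Q i) B u (F i).
Proof.
elim/big_rec2: _ => [|i x y _ <-]; first exact: B0r.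
by rewrite -[F i in LHS]scale1r B_linr rmorph1 mul1r.
Qed.

Definition lamp (h : G) (a : A) : lamps A G := [fsfun t in [fset h]%fset => a].

Lemma lamp_char_lamp n h a x :
  lamp_char act (thX n) (lamp h a) x = thX n (act h^-1%g x) a.
Proof.
rewrite (@lamp_char_big _ _ _ _ act _ _ _ [fset h]%fset) //.
  by rewrite big_seq_fset1 fsfunE inE eqxx.
apply/fsubsetP => t; rewrite mem_finsupp fsfunE inE.
by case: ifP => // _; rewrite eqxx.
Qed.

Lemma field_sum I (r : seq I) (Q : pred I) (F : I -> fields Z) x p :
  ((\sum_(i <- r | Q i) F i : fields Z) : field_space Z) x p =
  \sum_(i <- r | Q i) (F i : field_space Z) x p.
Proof. by elim/big_rec2: _ => [|i y z _ <-]. Qed.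

Section Cells.
Variable n : nat.
Notation K := (Kf n).
Implicit Types (c : cell n) (i : 'I_n).

(* [A] acts at lamp [h] through two distinct characters on the two sides. *)
Lemma B_distinct_cells (h a b : G) (E F : set X) c c' (u v : fields Z) :
  (forall x, E x -> lab n (act h^-1%g x) = c) ->
  (forall x, F x -> lab n (act h^-1%g x) = c') -> c != c' ->
  (u : field_space Z) = indicator n E a :> field ->
  (v : field_space Z) = indicator n F b :> field -> B u v = 0.
Proof.
move=> Ec Fc' /th_sep[s s_neq] uE vE.
pose w : W := Wreath (lamp h s) 1%g.
have tr (E' : set X) c0 b0 (u0 : fields Z) :
    (forall x, E' x -> lab n (act h^-1%g x) = c0) ->
    (u0 : field_space Z) = indicator n E' b0 :> field ->
    (th c0 s *: u0 : field_space Z) = translate thX w (u0 : field_space Z) :>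
      field.
  move=> E'c u0E; apply/funext => x; apply/funext => p.
  rewrite -[LHS]/(th c0 s * (u0 : field_space Z) x p) u0E /translate /=.
  rewrite invg1 act1 lamp_char_lamp /indicator.
  by case: asboolP => [[E'x ->]|]; rewrite ?mulr0 //= (E'c _ E'x).
(* The top part of [w] is trivial, so the two positions in [derivation] are measured from the same
   point and cancel: [B] is invariant under lamps. *)
have D0 : (0 : field_space Z) = derivation T l thX w^-1%g (th c s *: u :
  field_space Z) :> field.
  apply/funext => x; apply/funext => p; rewrite /derivation /= invgK invg1 act1.
  rewrite big1 ?mulr0 // => i _; by rewrite subrr mul0r.
have := B_form (tr _ _ _ _ Ec uE) (tr _ _ _ _ Fc' vE) D0.
rewrite polar0l addr0 BZl BZr mulrA => BE.
have [_ uc] := th_char c; have [_ uc'] := th_char c'.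
apply/eqP; apply: contraTT s_neq => B0; rewrite negbK; apply/eqP.
have : th c s * (th c' s)^*%C = 1.
  by apply: (mulIf B0); rewrite mul1r -BE.
move=> h1; have := sqcJ (th c' s); rewrite uc' rmorph1 => h2.
have c'0 : (th c' s)^*%C != 0.
  by apply/eqP => z; move: h1; rewrite z mulr0 => /esym/eqP; rewrite oner_eq0.
by apply: (mulIf c'0); rewrite h1.
Qed.

Definition shift (h : G) (E : set X) : set X := act h^-1%g @^-1` E.

Lemma measurable_set_shift h E : measurable E -> measurable (shift h E).
Proof.
have [_ mact _] := os_mp Z.
by move=> mE; rewrite /shift -[X in measurable X]setTI; exact: mact.
Qed.

Lemma sub_set_shift h E : E `<=` X0 -> shift h E `<=` X0.
Proof. by move=> EX x /EX; exact: (act_domE _ _).1. Qed.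

Lemma mu_shift h E : measurable E -> mu (shift h E) = mu E.
Proof. by have [_ _] := os_mp Z; apply. Qed.

Definition cells (Q : pred (cell n)) : set X := [set x | X0 x /\ Q (lab n x)].

Lemma measurable_cells Q : measurable (cells Q).
Proof.
have -> : cells Q = \bigcup_(c in [set c | Q c]) @cell_set n K c.
  apply/seteqP; split=> [x [X0x Qx]|x [c Qc [X0x lx]]]; first by exists (lab n
    x).
  by split=> //; rewrite lx.
apply: fin_bigcup_measurable => [|c _]; last exact: measurable_cell_set.
exact: finite_finset.
Qed.

Variable vec : set X * G -> fields Z.
Hypothesis vecE : forall E a, measurable E -> E `<=` X0 ->
  (vec (E, a) : field_space Z) = indicator n E a :> field.
Hypothesis sqn_vec : forall E a, measurable E -> E `<=` X0 ->
  sqn (vec (E, a)) = fine (mu E).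

Let mcell h c : measurable (shift h (@cell_set n K c)).
Proof. by apply: measurable_set_shift; exact: measurable_cell_set. Qed.

Let cellX0 h c : shift h (@cell_set n K c) `<=` X0.
Proof. by apply: sub_set_shift => x []. Qed.

Let vcellE h c a := vecE a (mcell h c) (@cellX0 h c).

Lemma vec_cells (Q : pred (cell n)) h a :
  vec (shift h (cells Q), a) = \sum_(c | Q c) vec (shift h (@cell_set n K c),
    a).
Proof.
apply: fieldsP => x p; rewrite field_sum vecE; last 2 first.
- by apply: measurable_set_shift; exact: measurable_cells.
- by apply: sub_set_shift => y [].
under eq_bigr do rewrite vcellE.
rewrite /indicator; case: asboolP => [[[X0x Qx] pE]|nQ].
  rewrite (bigD1 (lab n (act h^-1%g x))) //= big1 => [|c /andP[_ cx]].
    by rewrite asboolT ?addr0.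
  by rewrite asboolF // => -[[_ /= lx] _]; rewrite lx eqxx in cx.
rewrite big1 // => c Qc; rewrite asboolF // => -[[X0x /= lx] pE].
by apply: nQ; split=> //; split=> //=; rewrite lx.
Qed.

Notation m c := (fine (mu (@cell_set n K c))).

Lemma sqn_vec_cell h c a : sqn (vec (shift h (@cell_set n K c), a)) = m c.
Proof.
by rewrite sqn_vec ?mu_shift //; exact: measurable_cell_set.
Qed.

Lemma shift1 E : shift 1%g E = E.
Proof. by rewrite /shift; apply/seteqP; split=> x /=; rewrite invg1 act1. Qed.

Lemma mu_cells (Q : pred (cell n)) : \sum_(c | Q c) m c = fine (mu (cells Q)).
Proof.
have mQ := measurable_cells Q.
have QX : cells Q `<=` X0 by move=> x [].
rewrite -(sqn_vec 1%g mQ QX) -[cells Q]shift1 vec_cells sqn_sum_orthogonal.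
  by apply: eq_bigr => c _; rewrite sqn_vec_cell.
move=> c c' _ _ cc'; apply: polar_disjoint => x p _; rewrite !vcellE /indicator.
case: asboolP => [[[_ /= lx] _]|]; last by left.
right; rewrite asboolF // => -[[_ /= lx'] _].
by move: cc'; rewrite -lx -lx' eqxx.
Qed.

Lemma sum_all_cells : \sum_c m c = 1.
Proof.
rewrite mu_cells (_ : cells _ = X0); first by rewrite (opp_full opp).
by apply/seteqP; split=> x; [case|].
Qed.

Notation J := ('I_n * cell n)%type.
Notation hits := (fun q : J => hit q.2 q.1).
Notation jmp := (fun q : J => jump q.2 q.1).
(** With [g] the jump of [q], the field [u_ q] over [x] in the cell is supported at [g x], and
    [v_ q] over [g x] is supported at [x]. The field [eta] below is the diagonal: over each [x] it
    is supported at [x]. *)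
Let u_ (q : J) := vec (@cell_set n K q.2, jump q.2 q.1).
Let v_ (q : J) := vec (shift (jump q.2 q.1) (@cell_set n K q.2), (jump q.2
  q.1)^-1%g).
Let eta := vec (X0, 1%g).

Let uE q : (u_ q : field_space Z) = indicator n (@cell_set n K q.2) (jump q.2
  q.1) :> field.
Proof. by rewrite vecE //; [exact: measurable_cell_set | move=> x []]. Qed.

Let eta_sum h : eta = \sum_c vec (shift h (@cell_set n K c), 1%g).
Proof.
rewrite -(vec_cells xpredT) /eta; congr (vec (_, _)).
apply/seteqP; split=> x; rewrite /shift /cells /=; last by case=> /act_domE.
by move=> X0x; split=> //; apply/act_domE.
Qed.

Lemma sum_hits_le : \sum_(q : J | hits q) m q.2 <= n%:R.
Proof.
have m0 c : 0 <= m c by rewrite fine_ge0.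
apply: (@le_trans _ _ (\sum_(q : J) m q.2)).
  by rewrite [X in _ <= X](bigID hits) /= lerDl sumr_ge0.
rewrite -(pair_bigA _ (fun i c => m c)) /=.
under eq_bigr do rewrite sum_all_cells.
by rewrite sumr_const card_ord.
Qed.

Lemma sum_hits_ge : n%:R / 2 <= \sum_(q : J | hits q) m q.2.
Proof.
rewrite -(pair_big_dep xpredT (fun i c => hit c i) (fun i c => m c)) /=.
have -> : n%:R / 2 = \sum_(i < n) 2^-1 :> R.
  by rewrite sumr_const card_ord mulr_natl.
by apply: ler_sum => i _; rewrite mu_cells; have := Kf_half i; rewrite reachedE.
Qed.

(** Orthogonality is what Bessel's inequality needs: distinct [i] send the same point to distinct
    points by [T_index_inj], and for equal [i] the cells are disjoint. For the [v_ q] the same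
    argument is applied to the preimages under [T i]. *)
Lemma sqn_sum_u : sqn (\sum_(q | hits q) u_ q) = \sum_(q | hits q) m q.2.
Proof.
rewrite sqn_sum_orthogonal; first last.
  move=> [i c] [i' c'] /= hi hi' qq'; apply: polar_disjoint => x p X0x.
  rewrite !uE /indicator /=; case: asboolP => [[cx pE]|]; last by left.
  right; rewrite asboolF // => -[c'x].
  rewrite pE -(jumpP cx hi) -(jumpP c'x hi') => -[/(T_index_inj X0x)/val_inj
    ii'].
  by move: qq' cx c'x; rewrite ii' => qq' [_ /= lx] [_ /= lx']; rewrite -lx
    -lx' eqxx in qq'.
apply: eq_bigr => q _; rewrite sqn_vec //; first exact: measurable_cell_set.
by move=> x [].
Qed.

Lemma sqn_sum_v : sqn (\sum_(q | hits q) v_ q) = \sum_(q | hits q) m q.2.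
Proof.
rewrite sqn_sum_orthogonal; first by apply: eq_bigr => q _; exact: sqn_vec_cell.
move=> [i c] [i' c'] /= hi hi' qq'; apply: polar_disjoint => x p X0x.
rewrite !vcellE /indicator /=; case: asboolP => [[cx pE]|]; last by left.
right; rewrite asboolF // => -[c'x].
rewrite /shift /= in cx c'x; set z := act (jump c i)^-1%g x in cx pE.
rewrite pE => -[zE]; rewrite -zE in c'x.
have Ti : T i z = x by rewrite (jumpP cx hi) actVK.
have Ti' : T i' z = x by rewrite (jumpP c'x hi') zE actVK.
have ii' : i = i' by apply/val_inj/(T_index_inj (x := z)); [case: cx | rewrite
  Ti Ti'].
by case: cx c'x => _ /= lx [_ /= lx']; rewrite ii' -lx -lx' eqxx in qq'.
Qed.

(** Use the invariance of [B] under [g] with lamps off. On the diagonal over the cell, the only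
    surviving summand of the derivation is [i = q.1], with coefficient 1 - 0: seen from [g x], the
    point [x] lies in the ping-pong set; seen from itself, it does not. This contributes the measure
    of the cell. *)
Lemma B_jump (q : J) : hits q ->
  B (u_ q) (vec (@cell_set n K q.2, 1%g)) =
  B (vec (shift (jump q.2 q.1) (@cell_set n K q.2), 1%g)) (v_ q) + (m q.2)%:C%C.
Proof.
move=> hq; set g := jump q.2 q.1; set E := @cell_set n K q.2.
have mE : measurable E by exact: measurable_cell_set.
have EX : E `<=` X0 by move=> x [].
have Tx x : E x -> T q.1 x = act g x by move=> Ex; exact: jumpP.
pose w : W := Wreath (wreath_base (1%g : W)) g.
have chw w' k x : wreath_base w' = wreath_base (1%g : W) ->
    lamp_char act (thX k) (wreath_base w') x = 1.
  by move=> ->; apply: (lamp_char1 act) => y; exact: th_char.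
have chwV k x : lamp_char act (thX k) (wreath_base w^-1%g) x = 1.
  have thc k' y : character (thX k' y) by exact: th_char.
  have := chM thc w w^-1%g k (act g x); rewrite mulgV (chw 1%g) // mul1r.
  by rewrite /= actKV.
have [L [D [_ DE _ _]]] := exists_operators opp
  (fun k x => th_char (lab k x)) measurable_cell_character.
pose Lu := vec (shift g E, 1%g).
have LuE : (Lu : field_space Z) = translate thX w (u_ q : field_space Z) :>
  field.
  rewrite vcellE uE; apply/funext => x; apply/funext => p.
  rewrite /translate chw // mul1r /indicator; congr (_%:R); congr (nat_of_bool
    _).
  by apply: asbool_equiv_eq; rewrite /= actVK act1.
have LvE : (v_ q : field_space Z) =
    translate thX w (vec (E, 1%g) : field_space Z) :> field.
  rewrite vcellE vecE //; apply/funext => x; apply/funext => p.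
  rewrite /translate chw // mul1r /indicator; congr (_%:R); congr (nat_of_bool
    _).
  by apply: asbool_equiv_eq; rewrite /= act1.
rewrite (B_form LuE LvE (DE _ _)); congr (_ + _).
set v := vec (E, 1%g); set DLu := D _ _.
(* Only the values of [DLu] on the support of [v] matter, and there they equal 1. *)
suff rest0 : polar (DLu - v) v = 0.
  rewrite -[DLu](subrK v) polarDl rest0 add0r polar_self.
  by rewrite /v sqn_vec.
apply: polar_disjoint => x p X0x.
have vE : (v : field_space Z) x p = indicator n E 1%g x p by rewrite vecE.
rewrite vE; have [[Ex pE]|nE] := pselect (E x /\ p = (n, act 1%g x)); last
  first.
  by right; rewrite /indicator asboolF.
left; rewrite -[LHS]/((DLu : field_space Z) x p - (v : field_space Z) x p) vE.
rewrite DE /derivation chwV mul1r /= invgK pE act1 vcellE /indicator.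
rewrite [X in _ - X](_ : _ = 1); last by rewrite asboolT // act1.
rewrite (bigD1 q.1) //= big1 => [|i iq]; last first.
  rewrite asboolF ?mulr0 // => -[_ []]; rewrite act1 -(Tx _ Ex).
  by move=> /(T_index_inj X0x)/val_inj iq'; rewrite iq' eqxx in iq.
rewrite asboolT; last by rewrite /shift /= actKV act1 (Tx _ Ex).
have -> : l q.1 (act g x) x = true.
  have := opp_l4 opp q.1 (os_inv g X0x).
  by rewrite -[in X in l _ _ X](Tx _ Ex) (opp_T'K opp).
have -> : l q.1 x x = false by apply/negbTE; exact: opp_l3 opp _ _ X0x.
by rewrite subr0 mulr1 addr0 subrr.
Qed.

(** Split [eta] along the cells: [u_ q] pairs to 0 with every piece over a cell other than its own,
    by [B_distinct_cells] with the lamp at the unit. *)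
Lemma B_u_eta : B (\sum_(q | hits q) u_ q) eta =
  \sum_(q | hits q) B (u_ q) (vec (@cell_set n K q.2, 1%g)).
Proof.
rewrite B_suml; apply: eq_bigr => q _.
rewrite (eta_sum 1%g) B_sumr (bigD1 q.2) //= big1 => [|c cq].
  by rewrite addr0 shift1.
rewrite eq_sym in cq; apply: (B_distinct_cells (h := 1%g) _ _ cq (uE q) (vcellE
  1%g c 1%g)).
  by move=> x [_ /= <-]; rewrite invg1 act1.
by move=> x; rewrite shift1 => -[_ /= <-]; rewrite invg1 act1.
Qed.

(** Here the splitting of [eta] varies with [q]: it runs along the cells translated by the jump of
    [q], and the separating lamp sits at that jump. *)
Lemma B_eta_v : B eta (\sum_(q | hits q) v_ q) = \sum_(q | hits q)
  B (vec (shift (jump q.2 q.1) (@cell_set n K q.2), 1%g)) (v_ q).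
Proof.
rewrite B_sumr; apply: eq_bigr => q _.
rewrite (eta_sum (jump q.2 q.1)) B_suml (bigD1 q.2) //= big1 => [|c cq].
  by rewrite addr0.
apply: (B_distinct_cells (h := jump q.2 q.1) _ _ cq
    (vcellE (jump q.2 q.1) c 1%g) (vcellE (jump q.2 q.1) q.2 (jump q.2
      q.1)^-1%g)).
  by move=> x [_].
by move=> x [_].
Qed.

Lemma sqn_eta : sqn eta = 1.
Proof. by rewrite sqn_vec // (opp_full opp). Qed.

(** Summing [B_jump] writes the total mass [M] of the hits as a difference of two values of [B],
    each of squared modulus at most [C * M]. Thus [M ^+ 2 <= 4 * C * M], while [M] is at least
    [n / 2]. *)
Lemma level_bound : n%:R <= 16 * `|C|.
Proof.
set M := \sum_(q | hits q) m q.2.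
have ME : M%:C%C = B (\sum_(q | hits q) u_ q) eta + - B eta (\sum_(q | hits q)
  v_ q).
  rewrite B_u_eta B_eta_v -sumrB rmorph_sum; apply: eq_bigr => q hq.
  by rewrite B_jump // addrAC subrr add0r.
have M_ge : n%:R / 2 <= M := sum_hits_ge.
have M_le : M <= n%:R := sum_hits_le.
have sqM : M ^+ 2 <= 2 * (C * M + C * M).
  rewrite -sqc_real ME (le_trans (sqcD_le2 _ _)) // sqcN ler_pM2l // lerD //.
    by rewrite (le_trans (B_le _ _)) // sqn_sum_u sqn_eta mulr1.
  by rewrite (le_trans (B_le _ _)) // sqn_sum_v sqn_eta mul1r.
have [->|n0] := posnP n; first by rewrite mulr_ge0.
have n_gt0 : 0 < n%:R :> R by rewrite ltr0n.
have M0 : 0 < M by lra.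
have : M <= 4 * C.
  by rewrite -(ler_pM2r M0); move: sqM; rewrite expr2; lra.
by have := ler_norm C; lra.
Qed.

End Cells.

End NotUnitarizable.

Lemma reached_half_uniform (R : realType) (Z : orbit_space R) T T' l :
  @orbit_ping_pong R _ _ (os_mu Z) _ (@os_act R Z) os_dom T T' l ->
  forall n, exists K, forall i : 'I_n, 2^-1 <= fine (os_mu Z (reached T i K)).
Proof.
move=> opp n; have /choice[k kP] i := reached_half opp i.
exists (\max_(i < n) k i)%N => i; apply: (le_trans (kP i)).
apply: fine_le.
- by rewrite fin_num_measure //; exact: (measurable_reached opp).
- by rewrite fin_num_measure //; exact: (measurable_reached opp).
apply: le_measure; rewrite ?inE; try exact: (measurable_reached opp).
move=> x [X0x [j jk Tj]]; split=> //; exists j => //.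
exact: leq_trans jk (leq_bigmax i).
Qed.

(** Each level has its own finite family of cells and as many distinct characters of [A], whereas
    one form [B] and one constant [C] serve all levels; [level_bound] then bounds every [n]. *)
Lemma not_unitarizable_wreath (R : realType) (Z : orbit_space R) T T' l
    (A : groupType) :
  @orbit_ping_pong R _ _ (os_mu Z) _ (@os_act R Z) os_dom T T' l ->
  (forall x y : A, commute x y) -> infinite_set [set: A] ->
  ~ unitarizable R (wreath A (os_G Z)).
Proof.
move=> opp A_abelian A_infinite unit.
have /choice[Kf Kf_half] := reached_half_uniform opp.
pose cell n : finType := {ffun 'I_n * 'I_(Kf n) -> bool}.
pose th n := sval (cid (distinct_characters R A_abelian (cell n) A_infinite)).
have thP n := svalP (cid (distinct_characters R A_abelian (cell n) A_infinite)).
have th_char n c : character (th n c) := (thP n).1 c.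
have th_sep n c c' := (thP n).2 c c'.
have th_meas := measurable_cell_character opp th.
have [B [C [Bl Br B_le B_form]]] :=
  unitarizable_wreath_form opp (fun n x => th_char n _) th_meas unit.
have bound n : n%:R <= 16 * `|C|.
  have /choice[vec vecP] (q : set (os_X Z) * os_G Z) : exists u : fields Z,
      measurable q.1 -> q.1 `<=` os_dom ->
      (u : field_space Z) = indicator n q.1 q.2 :> (os_X Z -> nat * os_X Z ->
        R[i]) /\
      sqn u = fine (os_mu Z q.1).
    have [[mE EX]|nE] := pselect (measurable q.1 /\ q.1 `<=` os_dom).
      by have [u uE u_sqn] := exists_indicator n q.2 mE EX; exists u.
    by exists 0 => mE EX; case: nE.
  apply: (level_bound opp Kf_half th_char th_sep Bl Br B_le B_form).
  - by move=> E a mE EX; exact: (vecP (E, a) mE EX).1.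
  by move=> E a mE EX; exact: (vecP (E, a) mE EX).2.
(* The first natural number exceeding the bound. *)
have := bound (Num.truncn (16 * `|C|)).+1.
by rewrite leNgt truncnS_gt.
Qed.

Theorem theorem14 (R : realType) (G : groupType)
  (G_countable : countable [set: G]) (G_infinite : infinite_set [set: G])
  (F2_embeds : orbitally_embeds R F2 G)
  (A : groupType) (A_infinite : infinite_set [set: A])
  (A_abelian : forall x y : A, commute x y) :
  ~ unitarizable R (wreath A G).
Proof.
have [d [X [mu [alpha [beta [X_std [amp afree] [bmp bfree] orb]]]]]] :=
  F2_embeds.
have [X0 [T [T' [l opp]]]] :=
  exists_orbit_ping_pong X_std amp afree bmp bfree orb G_countable.
have [e e_bij] : exists e : nat -> nat * G, bijective e.
  have NG : countable [set: nat * G].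
    by rewrite -setXTT; apply: countableX; [exact: countableP | exact:
      G_countable].
  have NG_inf : infinite_set [set: nat * G].
    move=> NG_fin; apply: infinite_nat; apply: sub_finite_set (finite_image fst
      NG_fin).
    by move=> n _; exists (n, 1%g).
  have /card_set_bijP[f] := eq_card_nat NG NG_inf.
  by rewrite setTT_bijective => -[e fK eK]; exists e; exists f.
pose Z := OrbitSpace bmp (opp_meas opp) (opp_inv opp) (opp_free opp) e_bij.
exact: (@not_unitarizable_wreath R Z T T' l A opp A_abelian A_infinite).
Qed.
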